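(* Let $M$ be a monoid, $A$ a submonoid of $M$, $\varphi\colon A\to M$ an injective homomorphism, and put $B=\varphi(A)$. Let $L=\langle M,t\mid at=t\varphi(a),\ a\in A\rangle$ be the corresponding HNN-like Otto-Pride extension. Assume that $\mathbb ZM$ is flat as a right $\mathbb ZA$-module and as a left $\mathbb ZB$-module (via right and left multiplication, respectively), and let $1\le n\le\infty$. If $M$ is of type bi-$\mathrm{FP}_n$ and $A$ is of type bi-$\mathrm{FP}_{n-1}$, then $L$ is of type bi-$\mathrm{FP}_n$.
   Context: Convention: $\infty-1=\infty$. The Otto-Pride extension $L$ is the quotient of the monoid free product $M\ast\{t\}^*$ (with $\{t\}^*$ the free monoid on $t$) by the smallest congruence such that $at=t\varphi(a)$ for all $a\in A$; it is called HNN-like when $\varphi$ is injective. A monoid $N$ is of type bi-$\mathrm{FP}_n$ ($0\le n\le\infty$) if the $(\mathbb ZN,\mathbb ZN)$-bimodule $\mathbb ZN$ has a resolution $\cdots\to P_1\to P_0\to\mathbb ZN\to 0$ by projective $(\mathbb ZN,\mathbb ZN)$-bimodules with $P_i$ finitely generated for all $i\le n$ (for all $i$ if $n=\infty$). *)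

(* Defs.v *)
From HB Require Import structures.
From mathcomp Require Import all_boot all_order all_algebra.
From mathcomp Require Import boolp.
From mathcomp Require Import finmap.
From mathcomp Require Import monalg.

Set Implicit Arguments.
Unset Strict Implicit.
Unset Printing Implicit Defensive.

Import GRing.Theory.
Local Open Scope ring_scope.
Local Open Scope quotient_scope.

Inductive gen_cong (M : monoidType) (r : M -> M -> Prop) : M -> M -> Prop :=
| gen_cong_incl x y of r x y : gen_cong r x y
| gen_cong_refl x : gen_cong r x x
| gen_cong_sym x y of gen_cong r x y : gen_cong r y x
| gen_cong_trans x y z of gen_cong r x y & gen_cong r y z : gen_cong r x z
| gen_cong_mul x x' y y' of gen_cong r x x' & gen_cong r y y' :
    gen_cong r (x * y)%g (x' * y')%g.

Section MonoidQuotient.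
Variables (M : monoidType) (r : M -> M -> Prop).

Definition congb (x y : M) : bool := `[< gen_cong r x y >].

Lemma congb_equiv : equiv_class_of congb.
Proof.
split=> [x|x y|y x z].
- exact/asboolP/gen_cong_refl.
- by apply/asboolP/asboolP; apply: gen_cong_sym.
- move=> /asboolP xy /asboolP yz; apply/asboolP.
  exact: gen_cong_trans xy yz.
Qed.

Canonical congb_equiv_rel := EquivRelPack congb_equiv.
Canonical congb_encModRel := defaultEncModRel congb.

Definition mquot := {eq_quot congb}.
HB.instance Definition _ : EqQuotient M congb mquot := EqQuotient.on mquot.
HB.instance Definition _ := Choice.on mquot.

Definition mquot_pi (x : M) : mquot := \pi x.

Lemma mquotP x y : mquot_pi x = mquot_pi y <-> gen_cong r x y.
Proof.
by split=> [/eqmodP/asboolP //|h]; apply/eqmodP/asboolP.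
Qed.

Definition mquot_mul (a b : mquot) : mquot := mquot_pi (repr a * repr b)%g.

Lemma mquot_mulE x y :
  mquot_mul (mquot_pi x) (mquot_pi y) = mquot_pi (x * y)%g.
Proof.
by apply/mquotP; apply: gen_cong_mul; apply/mquotP; rewrite /mquot_pi reprK.
Qed.

Lemma mquotW (P : mquot -> Prop) : (forall x, P (mquot_pi x)) -> forall a, P a.
Proof. by move=> h a; rewrite -[a]reprK; apply: h. Qed.

Lemma mquot_mulA : associative mquot_mul.
Proof.
by elim/mquotW=> x; elim/mquotW=> y; elim/mquotW=> z; rewrite !mquot_mulE mulgA.
Qed.

Lemma mquot_mul1 : left_id (mquot_pi 1%g) mquot_mul.
Proof. by elim/mquotW=> x; rewrite mquot_mulE mul1g. Qed.

Lemma mquot_mulr1 : right_id (mquot_pi 1%g) mquot_mul.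
Proof. by elim/mquotW=> x; rewrite mquot_mulE mulg1. Qed.

HB.instance Definition _ := isMonoid.Build mquot
  mquot_mulA mquot_mul1 mquot_mulr1.

Lemma mquot_pi_monoid : monoid.monoid_morphism mquot_pi.
Proof. by split=> // x y; rewrite -mquot_mulE. Qed.
HB.instance Definition _ := isUMagmaMorphism.Build M mquot mquot_pi
  mquot_pi_monoid.

End MonoidQuotient.

Definition free_monoid (T : choiceType) : Type := seq T.
HB.instance Definition _ (T : choiceType) := Choice.on (free_monoid T).
HB.instance Definition _ (T : choiceType) :=
  isMonoid.Build (free_monoid T) (@catA T) (@cat0s T) (@cats0 T).

Section FreeProduct.
Variables M N : monoidType.

(* The free product is the monoid of words in the disjoint union of M and N,
   modulo the multiplication tables of M and N. *)
Inductive free_prod_rel : free_monoid (M + N)%type ->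
                          free_monoid (M + N)%type -> Prop :=
| free_prod_mull x y : free_prod_rel [:: inl x; inl y] [:: inl (x * y)%g]
| free_prod_1l : free_prod_rel [:: inl 1%g] [::]
| free_prod_mulr x y : free_prod_rel [:: inr x; inr y] [:: inr (x * y)%g]
| free_prod_1r : free_prod_rel [:: inr 1%g] [::].

Definition free_prod := mquot free_prod_rel.
HB.instance Definition _ := Monoid.on free_prod.

Definition free_prod_inl (x : M) : free_prod := mquot_pi free_prod_rel [:: inl x].
Definition free_prod_inr (y : N) : free_prod := mquot_pi free_prod_rel [:: inr y].

Lemma free_prod_inl_monoid : monoid.monoid_morphism free_prod_inl.
Proof.
split=> [|x y]; first exact/mquotP/gen_cong_incl/free_prod_1l.
rewrite -[RHS]gmulfM; apply/mquotP/gen_cong_sym/gen_cong_incl.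
exact: free_prod_mull.
Qed.
HB.instance Definition _ := isUMagmaMorphism.Build M free_prod free_prod_inl
  free_prod_inl_monoid.

Lemma free_prod_inr_monoid : monoid.monoid_morphism free_prod_inr.
Proof.
split=> [|x y]; first exact/mquotP/gen_cong_incl/free_prod_1r.
rewrite -[RHS]gmulfM; apply/mquotP/gen_cong_sym/gen_cong_incl.
exact: free_prod_mulr.
Qed.
HB.instance Definition _ := isUMagmaMorphism.Build N free_prod free_prod_inr
  free_prod_inr_monoid.

End FreeProduct.

Section OttoPride.
Variables (M : monoidType) (S : {pred M}) (A : subMonoidType S).
Variable phi : UMagmaMorphism.type A M.

(* The free monoid on t is [free_monoid unit]. *)
Let F := free_prod M (free_monoid unit).
Let t : F := @free_prod_inr M (free_monoid unit) [:: tt].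
Let inM (m : M) : F := @free_prod_inl M (free_monoid unit) m.

Inductive otto_pride_rel : F -> F -> Prop :=
| otto_pride_at (a : A) :
    otto_pride_rel (inM (val a) * t)%g (t * inM (phi a))%g.

Definition otto_pride := mquot otto_pride_rel.
HB.instance Definition _ := Monoid.on otto_pride.

End OttoPride.

Section MonoidImage.
Variables (A M : monoidType) (phi : UMagmaMorphism.type A M).

Definition in_image : {pred M} := fun m => `[< exists a, phi a = m >].

Definition image_monoid : Type := {m : M | in_image m}.
HB.instance Definition _ := SubChoice.on image_monoid.

Lemma in_image_closed : monoid_closed in_image.
Proof.
split=> [|_ _ /asboolP[a <-] /asboolP[b <-]]; apply/asboolP.
  by exists 1%g; rewrite gmulf1.
by exists (a * b)%g; rewrite gmulfM.
Qed.
HB.instance Definition _ :=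
  SubChoice_isSubMonoid.Build M in_image image_monoid in_image_closed.

End MonoidImage.

(* [mlift h] is the additive extension of h : K -> V to the free abelian group
   {malg int[K]}. *)
Section Lift.
Variables (K : choiceType) (V : zmodType) (h : K -> V).

Definition mlift (g : {malg int[K]}) : V := \sum_(k <- msupp g) h k *~ g@_k.

Lemma mliftw (d : {fset K}) g : (msupp g `<=` d)%fset ->
  mlift g = \sum_(k <- d) h k *~ g@_k.
Proof.
move=> gd; apply: (big_fset_incl _ gd) => k _ /mcoeff_outdom ->.
by rewrite mulr0z.
Qed.

Lemma mlift_is_zmod : zmod_morphism mlift.
Proof.
move=> g1 g2; set d := (msupp g1 `|` msupp g2)%fset.
rewrite (mliftw (d := d) (msuppB_le g1 g2)) (mliftw (d := d) (fsubsetUl _ _)).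
rewrite (mliftw (d := d) (fsubsetUr _ _)) -sumrB; apply: eq_bigr => k _.
by rewrite mcoeffB mulrzBr.
Qed.
HB.instance Definition _ :=
  GRing.isZmodMorphism.Build {malg int[K]} V mlift mlift_is_zmod.

Lemma mliftU k : mlift << k >> = h k.
Proof. by rewrite (mliftw (msuppU_le)) big_seq_fset1 mcoeffUU mulr1z. Qed.

End Lift.

Lemma malg_ext (K : choiceType) (V : zmodType) (f f' : {malg int[K]} -> V) :
  zmod_morphism f -> zmod_morphism f' ->
  (forall k, f << k >> = f' << k >>) -> f =1 f'.
Proof.
move=> fB f'B ff' g.
pose fa : {additive _ -> V} := HB.pack f (GRing.isZmodMorphism.Build _ _ f fB).
pose fa' : {additive _ -> V} :=
  HB.pack f' (GRing.isZmodMorphism.Build _ _ f' f'B).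
rewrite -[f]/(fa : _ -> _) -[f']/(fa' : _ -> _) [g]monalgE !raddf_sum.
apply: eq_bigr => k _; rewrite -[g@_k]intz.
by rewrite raddfMz !(raddfMz fa, raddfMz fa') /= ff'.
Qed.

Definition monoid_ring (M : monoidType) : Type := {malg int[M]}.
HB.instance Definition _ (M : monoidType) := GRing.Zmodule.on (monoid_ring M).

Section MonoidRing.
Variable M : monoidType.
Implicit Types f g h : monoid_ring M.

Definition mr_mul f g : monoid_ring M :=
  mlift (fun x => mlift (fun y => << (x * y)%g >>) g) f.

Lemma mr_mulUU x y : mr_mul << x >> << y >> = << (x * y)%g >>.
Proof. by rewrite /mr_mul !mliftU. Qed.

Lemma mr_mulBl g : zmod_morphism (mr_mul^~ g).
Proof. by move=> f f'; apply: raddfB. Qed.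

Lemma mr_mulBr f : zmod_morphism (mr_mul f).
Proof.
move=> g g'; rewrite /mr_mul /mlift -sumrB; apply: eq_bigr => x _ /=.
by rewrite -mulrzBl -/(mlift _ (g - g')) raddfB.
Qed.

Lemma mr_mulA : associative mr_mul.
Proof.
move=> f g h.
apply: (malg_ext (f := mr_mul^~ (mr_mul g h))
                 (f' := fun f => mr_mul (mr_mul f g) h)) => [||x].
- exact: mr_mulBl.
- by move=> ? ?; rewrite !mr_mulBl.
apply: (malg_ext (f := fun g => mr_mul << x >> (mr_mul g h))
                 (f' := fun g => mr_mul (mr_mul << x >> g) h)) => [||y].
- by move=> ? ?; rewrite mr_mulBl mr_mulBr.
- by move=> ? ?; rewrite mr_mulBr mr_mulBl.
apply: (malg_ext (f := fun h => mr_mul << x >> (mr_mul << y >> h))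
                 (f' := mr_mul (mr_mul << x >> << y >>))) => [||z].
- by move=> ? ?; rewrite !mr_mulBr.
- exact: mr_mulBr.
by rewrite !mr_mulUU mulgA.
Qed.

Lemma mr_mul1 : left_id << 1%g >> mr_mul.
Proof.
apply: (malg_ext (f' := id)) => [||x]; [exact: mr_mulBr | by [] |].
by rewrite mr_mulUU mul1g.
Qed.

Lemma mr_mulr1 : right_id << 1%g >> mr_mul.
Proof.
apply: (malg_ext (f := mr_mul^~ _) (f' := id)) => [||x].
- exact: mr_mulBl.
- by [].
by rewrite mr_mulUU mulg1.
Qed.

Lemma mr_mulDl : left_distributive mr_mul +%R.
Proof. by move=> f f' g; apply: raddfD. Qed.

Lemma mr_mulDr : right_distributive mr_mul +%R.
Proof.
move=> f g g'; apply: (addIr (- mr_mul f g')).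
by rewrite -mr_mulBr !addrK.
Qed.

Lemma mr_1neq0 : (<< 1%g >> : monoid_ring M) != 0.
Proof. by rewrite monalgU_eq0. Qed.

HB.instance Definition _ := GRing.Zmodule_isNzRing.Build (monoid_ring M)
  mr_mulA mr_mul1 mr_mulr1 mr_mulDl mr_mulDr mr_1neq0.

End MonoidRing.

Section MonoidRingMap.
Variables (M N : monoidType) (f : UMagmaMorphism.type M N).

Definition monoid_ring_map : monoid_ring M -> monoid_ring N :=
  mlift (fun x => << f x >>).

Lemma monoid_ring_map_zmod : zmod_morphism monoid_ring_map.
Proof. exact: raddfB. Qed.
HB.instance Definition _ := GRing.isZmodMorphism.Build
  (monoid_ring M) (monoid_ring N) monoid_ring_map monoid_ring_map_zmod.

Lemma monoid_ring_map_monoid : GRing.monoid_morphism monoid_ring_map.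
Proof.
split=> [|u v]; first by rewrite /monoid_ring_map mliftU gmulf1.
apply: (malg_ext (f := fun u : monoid_ring M => monoid_ring_map (u * v))
  (f' := fun u => monoid_ring_map u * monoid_ring_map v)) => [||x /=].
- by move=> a b; rewrite mulrBl raddfB.
- by move=> a b; rewrite raddfB mulrBl.
move: v; apply: (malg_ext
  (f := fun v => monoid_ring_map ((<< x >> : monoid_ring M) * v))
  (f' := fun v => monoid_ring_map << x >> * monoid_ring_map v)) => [||y].
- by move=> a b; rewrite mulrBr raddfB.
- by move=> a b; rewrite raddfB mulrBr.
by rewrite [_ * _]mr_mulUU /monoid_ring_map !mliftU gmulfM -mr_mulUU.
Qed.
HB.instance Definition _ := GRing.isMonoidMorphism.Build
  (monoid_ring M) (monoid_ring N) monoid_ring_map monoid_ring_map_monoid.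

End MonoidRingMap.

(* Right R-modules are left modules over the converse ring R^c. *)

Section RestrictScalars.
Variables (R S : pzRingType) (f : {rmorphism R -> S}).

Definition lrestr : Type := let _ := f in S.
HB.instance Definition _ := GRing.Zmodule.on lrestr.

Definition lrestr_scale (a : R) (x : lrestr) : lrestr := f a * (x : S).

Lemma lrestr_scaleA a b x :
  lrestr_scale a (lrestr_scale b x) = lrestr_scale (a * b) x.
Proof. by rewrite /lrestr_scale rmorphM mulrA. Qed.
Lemma lrestr_scale1 : left_id 1 lrestr_scale.
Proof. by move=> x; rewrite /lrestr_scale rmorph1 mul1r. Qed.
Lemma lrestr_scaleDr : right_distributive lrestr_scale +%R.
Proof. by move=> a x y; rewrite /lrestr_scale mulrDr. Qed.
Lemma lrestr_scaleDl x : {morph lrestr_scale^~ x : a b / a + b}.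
Proof. by move=> a b; rewrite /lrestr_scale rmorphD mulrDl. Qed.
HB.instance Definition _ := GRing.Zmodule_isLmodule.Build R lrestr
  lrestr_scaleA lrestr_scale1 lrestr_scaleDr lrestr_scaleDl.

Definition rrestr : Type := let _ := f in S.
HB.instance Definition _ := GRing.Zmodule.on rrestr.

Definition rrestr_scale (a : R^c) (x : rrestr) : rrestr := (x : S) * f a.

Lemma rrestr_scaleA a b x :
  rrestr_scale a (rrestr_scale b x) = rrestr_scale (a * b) x.
Proof. by rewrite /rrestr_scale [f (a * b)]rmorphM mulrA. Qed.
Lemma rrestr_scale1 : left_id 1 rrestr_scale.
Proof. by move=> x; rewrite /rrestr_scale [f _]rmorph1 mulr1. Qed.
Lemma rrestr_scaleDr : right_distributive rrestr_scale +%R.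
Proof. by move=> a x y; rewrite /rrestr_scale mulrDl. Qed.
Lemma rrestr_scaleDl x : {morph rrestr_scale^~ x : a b / a + b}.
Proof. by move=> a b; rewrite /rrestr_scale [f _]rmorphD mulrDr. Qed.
HB.instance Definition _ := GRing.Zmodule_isLmodule.Build R^c rrestr
  rrestr_scaleA rrestr_scale1 rrestr_scaleDr rrestr_scaleDl.

End RestrictScalars.

Section Subgroup.
Variables (V : zmodType) (G : V -> Prop).

Inductive gen_subgroup : V -> Prop :=
| gen_subgroup_incl x of G x : gen_subgroup x
| gen_subgroup_0 : gen_subgroup 0
| gen_subgroup_B x y of gen_subgroup x & gen_subgroup y : gen_subgroup (x - y).

Definition in_gen_subgroup : {pred V} := fun x => `[< gen_subgroup x >].

Lemma in_gen_subgroup_closed : zmod_closed in_gen_subgroup.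
Proof.
split=> [|x y /asboolP hx /asboolP hy]; apply/asboolP.
  exact: gen_subgroup_0.
exact: gen_subgroup_B.
Qed.
HB.instance Definition _ :=
  GRing.isZmodClosed.Build V in_gen_subgroup in_gen_subgroup_closed.

End Subgroup.

Section Tensor.
Variables (R : pzRingType) (X : lmodType R^c) (Y : lmodType R).

(* [(a : R^c) *: x] is the right action x a. *)
Inductive tensor_rel : {malg int[(X * Y)%type]} -> Prop :=
| tensor_relDl x x' y :
    tensor_rel (<< (x + x', y) >> - << (x, y) >> - << (x', y) >>)
| tensor_relDr x y y' :
    tensor_rel (<< (x, y + y') >> - << (x, y) >> - << (x, y') >>)
| tensor_relZ (a : R) x y :
    tensor_rel (<< ((a : R^c) *: x, y) >> - << (x, a *: y) >>).

Definition tensor := Quotient.quot (in_gen_subgroup tensor_rel).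
HB.instance Definition _ := GRing.Zmodule.on tensor.

Definition tensor_pi (z : {malg int[(X * Y)%type]}) : tensor := \pi z.

Definition tens (x : X) (y : Y) : tensor := tensor_pi << (x, y) >>.

Lemma tensor_pi_zmod : zmod_morphism tensor_pi.
Proof. by move=> u v; rewrite /tensor_pi !piE. Qed.
HB.instance Definition _ :=
  GRing.isZmodMorphism.Build _ tensor tensor_pi tensor_pi_zmod.

Lemma tensor_piP u v : tensor_pi u = tensor_pi v <-> gen_subgroup tensor_rel (u - v).
Proof.
rewrite /tensor_pi; split=> [/eqP|h]; last first.
  by apply/eqP; rewrite -Quotient.idealrBE; apply/asboolP.
by rewrite -Quotient.idealrBE => /asboolP.
Qed.

End Tensor.
Arguments tensor_pi [R] X Y z.

Section TensorMap.
Variables (R : pzRingType) (X X' : lmodType R^c) (Y Y' : lmodType R).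
Variables (f : {linear X -> X'}) (g : {linear Y -> Y'}).

Local Notation push := (mlift (fun p : (X * Y)%type => << (f p.1, g p.2) >>)).

Definition tensor_map (z : tensor X Y) : tensor X' Y' :=
  tensor_pi X' Y' (push (repr z)).

Lemma tensor_map_pi u : tensor_map (tensor_pi X Y u) = tensor_pi X' Y' (push u).
Proof.
apply/tensor_piP; rewrite -raddfB.
have /tensor_piP : tensor_pi X Y (repr (tensor_pi X Y u)) = tensor_pi X Y u.
  by rewrite /tensor_pi reprK.
elim=> [_ []|| a b _ IHa _ IHb].
- move=> x x' y; rewrite !raddfB /= !mliftU /= raddfD.
  exact/gen_subgroup_incl/tensor_relDl.
- move=> x y y'; rewrite !raddfB /= !mliftU /= raddfD.
  exact/gen_subgroup_incl/tensor_relDr.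
- move=> a x y; rewrite !raddfB /= !mliftU /= !linearZ_LR.
  exact/gen_subgroup_incl/tensor_relZ.
- by rewrite raddf0; apply: gen_subgroup_0.
by rewrite raddfB; apply: gen_subgroup_B.
Qed.

Lemma tensor_mapE x y : tensor_map (tens x y) = tens (f x) (g y).
Proof. by rewrite tensor_map_pi mliftU. Qed.

Lemma tensor_map_zmod : zmod_morphism tensor_map.
Proof.
move=> a b; have [u ->] : exists u, a = tensor_pi X Y u.
  by exists (repr a); rewrite /tensor_pi reprK.
have [v ->] : exists v, b = tensor_pi X Y v.
  by exists (repr b); rewrite /tensor_pi reprK.
by rewrite -raddfB !tensor_map_pi !raddfB.
Qed.
HB.instance Definition _ := GRing.isZmodMorphism.Build
  (tensor X Y) (tensor X' Y') tensor_map tensor_map_zmod.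

End TensorMap.

Definition flat_right (R : pzRingType) (X : lmodType R^c) : Prop :=
  forall (Y Y' : lmodType R) (g : {linear Y -> Y'}),
    injective g -> injective (tensor_map (idfun : {linear X -> X}) g).

Definition flat_left (R : pzRingType) (Y : lmodType R) : Prop :=
  forall (X X' : lmodType R^c) (f : {linear X -> X'}),
    injective f -> injective (tensor_map f (idfun : {linear Y -> Y})).

HB.mixin Record Lmodule_isBimodule (R S : pzRingType) V of GRing.Lmodule R V := {
  rscale : V -> S -> V;
  rscaleA : forall x b c, rscale (rscale x b) c = rscale x (b * c);
  rscale1 : forall x, rscale x 1 = x;
  rscaleDl : forall x y b, rscale (x + y) b = rscale x b + rscale y b;
  rscaleDr : forall x b c, rscale x (b + c) = rscale x b + rscale x c;
  scale_rscale : forall a x b, a *: rscale x b = rscale (a *: x) b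
}.

#[short(type="bimodType")]
HB.structure Definition Bimodule (R S : pzRingType) :=
  {V of GRing.Lmodule R V & Lmodule_isBimodule R S V}.

Section RegularBimodule.
Variable R : pzRingType.

Definition reg_rscale (x : R^o) (b : R) : R^o := (x : R) * b.

Fact reg_rscaleA x b c : reg_rscale (reg_rscale x b) c = reg_rscale x (b * c).
Proof. by rewrite /reg_rscale mulrA. Qed.
Fact reg_rscale1 x : reg_rscale x 1 = x.
Proof. exact: mulr1. Qed.
Fact reg_rscaleDl x y b : reg_rscale (x + y) b = reg_rscale x b + reg_rscale y b.
Proof. exact: mulrDl. Qed.
Fact reg_rscaleDr x b c : reg_rscale x (b + c) = reg_rscale x b + reg_rscale x c.
Proof. exact: mulrDr. Qed.
Fact reg_scale_rscale (a : R) x b :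
  a *: reg_rscale x b = reg_rscale (a *: x) b.
Proof. exact: mulrA. Qed.
HB.instance Definition _ := Lmodule_isBimodule.Build R R R^o
  reg_rscaleA reg_rscale1 reg_rscaleDl reg_rscaleDr reg_scale_rscale.

End RegularBimodule.

Section BimoduleTheory.
Variables R S : pzRingType.

Definition bimod_hom (X Y : bimodType R S) (f : X -> Y) : Prop :=
  linear f /\ forall x (b : S), f (rscale x b) = rscale (f x) b.

Definition surj (X Y : Type) (f : X -> Y) : Prop := forall y, exists x, f x = y.

Definition projective_bimod (P : bimodType R S) : Prop :=
  forall (X Y : bimodType R S) (g : X -> Y) (f : P -> Y),
    bimod_hom g -> surj g -> bimod_hom f ->
    exists2 h : P -> X, bimod_hom h & forall p, g (h p) = f p.

Definition fg_bimod (P : bimodType R S) : Prop :=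
  exists (m : nat) (e : 'I_m -> P), forall x : P,
    exists s : seq (R * 'I_m * S),
      x = \sum_(u <- s) rscale (u.1.1 *: e u.1.2) u.2.

Record projective_resolution (V : bimodType R S) (P : nat -> bimodType R S)
    (d : forall i, P i.+1 -> P i) (aug : P 0%N -> V) : Prop := {
  res_projective : forall i, projective_bimod (P i);
  res_aug_hom : bimod_hom aug;
  res_d_hom : forall i, bimod_hom (d i);
  res_aug_surj : surj aug;
  res_exact0 : forall x, aug x = 0 <-> exists y, d 0%N y = x;
  res_exactS : forall i x, d i x = 0 <-> exists y, d i.+1 y = x
}.

End BimoduleTheory.

(* The extended natural numbers: [None] is oo. *)
Definition enat := option nat.
Definition enat_le (i : nat) (n : enat) : Prop :=
  if n is Some m then (i <= m)%N else True.
(* oo - 1 = oo *)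
Definition enat_pred (n : enat) : enat := omap predn n.

Definition bi_FP (n : enat) (N : monoidType) : Prop :=
  let ZN := monoid_ring N in
  exists (P : nat -> bimodType ZN ZN) (d : forall i, P i.+1 -> P i)
         (aug : P 0%N -> ZN^o),
    projective_resolution d aug /\ forall i, enat_le i n -> fg_bimod (P i).

(* Main.v *)
(* Write T = ZL, R = ZM, and let t also denote its image in T. An R-derivation on
   T is determined by its value on t, which can be any v with a v = v phi(a), so
   the bimodule of relative differentials gives an exact sequence
     0 -> T (x)_ZA T -> T (x)_R T -> T -> 0,  1 (x) 1 |-> t (x) 1 - 1 (x) t,
   where ZA acts on the left factor by inclusion and on the right one via phi.
   Induction turns the resolutions of ZA and ZM into resolutions of the first two
   terms, and the mapping cone of a lift resolves T. Induction on the right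
   preserves exactness because a bimodule resolution of ZN splits as right modules
   (projective bimodules are right projective, by coinduction); induction on the
   left does because T is right flat over R, hence over ZA. The latter holds since
   T (x)_R Y is the sum over k of the modules obtained from Y by k applications of
   W |-> R (x)_ZA phi^*W, and these preserve injections when R is right flat over
   ZA. *)

From HB Require Import structures.
From mathcomp Require Import all_boot all_order all_algebra.
From mathcomp Require Import boolp functions finmap monalg.
Require Import Defs.

Set Implicit Arguments.
Unset Strict Implicit.
Unset Printing Implicit Defensive.

Import GRing.Theory.
Local Open Scope ring_scope.

(** The extension L is met only through generation by M and t and through its universal property, so
    that no normal form for its elements enters. Coordinates on T (x)_R Y come from an action of L
    on families of elements of the layers, and for flatness it is enough that an element is
    determined by its coordinates. Derivations on T come from morphisms of L into a split extension
    of L by a bimodule. The derivation D with D(t) = 1 (x) 1 gives the map x (x) y |-> D(x) y, which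
    retracts the first map of the sequence of differentials; both its injectivity and exactness in
    the middle follow from this retraction. Induction on the right precedes induction on the left:
    the contracting maps of a bimodule resolution are right linear but not left linear, so they
    survive tensoring with T on the right only. The mapping cone places the resolution coming from A
    one degree higher, which accounts for n - 1. *)

(** * Additive and linear maps; induction on free abelian groups *)

Definition additive_of (U V : zmodType) (f : U -> V) (fB : zmod_morphism f) :
    {additive U -> V} :=
  HB.pack f (GRing.isZmodMorphism.Build U V f fB).

Lemma zmod_morphD (U V : zmodType) (f : U -> V) :
  zmod_morphism f -> {morph f : x y / x + y}.
Proof. by move=> fB x y; apply: (raddfD (additive_of fB)). Qed.

Lemma zmod_morph_additive (U V : zmodType) (f : U -> V) :
  {morph f : x y / x + y} -> zmod_morphism f.
Proof. by move=> fD x y; apply: (addIr (f y)); rewrite subrK -fD subrK. Qed.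

Lemma zmod_morph0 (U V : zmodType) (f : U -> V) : zmod_morphism f -> f 0 = 0.
Proof. by move=> fB; apply: (raddf0 (additive_of fB)). Qed.

Lemma zmod_morphN (U V : zmodType) (f : U -> V) :
  zmod_morphism f -> {morph f : x / - x}.
Proof. by move=> fB x; apply: (raddfN (additive_of fB)). Qed.

Lemma zmod_morph_sum (U V : zmodType) (f : U -> V) :
  zmod_morphism f -> forall (I : Type) (r : seq I) (P : pred I) (F : I -> U),
  f (\sum_(i <- r | P i) F i) = \sum_(i <- r | P i) f (F i).
Proof. by move=> fB I r P F; apply: (raddf_sum (additive_of fB)). Qed.

Definition linear_of (R : pzRingType) (U V : lmodType R) (f : U -> V)
    (f_lin : linear f) : {linear U -> V} :=
  HB.pack f (GRing.isLinear.Build R U V *:%R f f_lin).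

Lemma zmod_scalable_linear (R : pzRingType) (U V : lmodType R) (f : U -> V) :
  zmod_morphism f -> (forall a x, f (a *: x) = a *: f x) -> linear f.
Proof. by move=> fB fZ a x y; rewrite (zmod_morphD fB) fZ. Qed.

Lemma linear_zmod (R : pzRingType) (U V : lmodType R) (f : U -> V) :
  linear f -> zmod_morphism f.
Proof. by move=> f_lin x y; apply: (raddfB (linear_of f_lin)). Qed.

Lemma linear_scalable (R : pzRingType) (U V : lmodType R) (f : U -> V) :
  linear f -> forall a x, f (a *: x) = a *: f x.
Proof. by move=> f_lin a x; apply: (linearZ_LR (linear_of f_lin)). Qed.

Lemma malg_ind (K : choiceType) (P : {malg int[K]} -> Prop) :
  (forall k, P << k >>) -> P 0 -> (forall u v, P u -> P v -> P (u - v)) ->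
  forall x, P x.
Proof.
move=> PU P0 PB.
have PN u : P u -> P (- u) by move=> Pu; rewrite -sub0r; apply: PB.
have PD u v : P u -> P v -> P (u + v).
  by move=> Pu Pv; rewrite -[v]opprK; apply/PB/PN.
have Pn u (n : nat) : P u -> P (u *+ n).
  by move=> Pu; elim: n => [|n IHn]; rewrite ?mulr0n // mulrS; apply: PD.
have Pz u (n : int) : P u -> P (u *~ n).
  by case: n => n Pu; rewrite ?NegzE ?mulrNz -?pmulrn; [|apply: PN]; apply: Pn.
move=> x; rewrite [x]monalgE; apply: (big_ind P) => // k _.
by rewrite -[_@_ _]intz raddfMz; apply/Pz/PU.
Qed.

Lemma monoid_ringUU (N : monoidType) (x y : N) :
  (<< x >> : monoid_ring N) * << y >> = << (x * y)%g >>.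
Proof. exact: mr_mulUU. Qed.

Lemma monoid_ring_mapU (N N' : monoidType) (f : UMagmaMorphism.type N N')
    (x : N) :
  monoid_ring_map f << x >> = << f x >>.
Proof. exact: mliftU. Qed.

(** * Tensor products *)

Section TensorTheory.
Variables (R : pzRingType) (X : lmodType R^c) (Y : lmodType R).

Lemma tens_zmodl (y : Y) : zmod_morphism (fun x : X => tens x y).
Proof.
apply: zmod_morph_additive => x x'.
rewrite /tens -raddfD; apply/tensor_piP; rewrite opprD addrA.
exact/gen_subgroup_incl/tensor_relDl.
Qed.

Lemma tens_zmodr (x : X) : zmod_morphism (fun y : Y => tens x y).
Proof.
apply: zmod_morph_additive => y y'.
rewrite /tens -raddfD; apply/tensor_piP; rewrite opprD addrA.
exact/gen_subgroup_incl/tensor_relDr.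
Qed.

Lemma tensZ (a : R) (x : X) (y : Y) : tens ((a : R^c) *: x) y = tens x (a *: y).
Proof. exact/tensor_piP/gen_subgroup_incl/tensor_relZ. Qed.

Lemma tensor_ext (V : zmodType) (f g : tensor X Y -> V) :
  zmod_morphism f -> zmod_morphism g ->
  (forall x y, f (tens x y) = g (tens x y)) -> f =1 g.
Proof.
move=> fB gB fg z; rewrite -[z]reprK -/(tensor_pi X Y (repr z)).
apply: (malg_ext (f := f \o tensor_pi X Y) (f' := g \o tensor_pi X Y)).
- by move=> u v; rewrite /= raddfB fB.
- by move=> u v; rewrite /= raddfB gB.
- by case=> x y; apply: fg.
Qed.

Lemma tensor_ind (P : tensor X Y -> Prop) :
  (forall x y, P (tens x y)) -> (forall u v, P u -> P v -> P (u - v)) ->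
  forall z, P z.
Proof.
move=> Pt PB; have P0 : P 0 by rewrite -(subrr (tens 0 0)); apply: PB.
move=> z; rewrite -[z]reprK -/(tensor_pi X Y (repr z)).
apply: (malg_ind (P := P \o tensor_pi X Y)) => [[x y]||u v Pu Pv] /=.
- exact: Pt.
- by rewrite raddf0.
- by rewrite raddfB; apply: PB.
Qed.

Section Lift.
Variables (V : zmodType) (h : X -> Y -> V).
Hypothesis hBl : forall y, zmod_morphism (h^~ y).
Hypothesis hBr : forall x, zmod_morphism (h x).
Hypothesis hZ : forall (a : R) x y, h ((a : R^c) *: x) y = h x (a *: y).

(** Evaluated on a representative and defined for every [h], balanced or not. Maps can thus be built
    by recursion through it, with their additivity and linearity proved afterwards. *)
Definition tensor_lift (z : tensor X Y) : V :=
  mlift (fun p : (X * Y)%type => h p.1 p.2) (repr z).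

Lemma tensor_lift_pi u :
  tensor_lift (tensor_pi X Y u) = mlift (fun p : (X * Y)%type => h p.1 p.2) u.
Proof.
apply/eqP; rewrite -subr_eq0 -raddfB; apply/eqP.
have /tensor_piP : tensor_pi X Y (repr (tensor_pi X Y u)) = tensor_pi X Y u.
  by rewrite /tensor_pi reprK.
elim=> [_ []|| a b _ IHa _ IHb].
- move=> x x' y; rewrite !raddfB /= !mliftU /= (zmod_morphD (hBl y)).
  by rewrite addrAC addrK subrr.
- move=> x y y'; rewrite !raddfB /= !mliftU /= (zmod_morphD (hBr x)).
  by rewrite addrAC addrK subrr.
- by move=> a x y; rewrite !raddfB /= !mliftU /= hZ subrr.
- by rewrite raddf0.
by rewrite raddfB IHa IHb subrr.
Qed.

Lemma tensor_liftE x y : tensor_lift (tens x y) = h x y.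
Proof. by rewrite tensor_lift_pi mliftU. Qed.

Lemma tensor_lift_zmod : zmod_morphism tensor_lift.
Proof.
move=> a b; rewrite -[a]reprK -[b]reprK.
rewrite -/(tensor_pi X Y (repr a)) -/(tensor_pi X Y (repr b)).
by rewrite -raddfB !tensor_lift_pi raddfB.
Qed.

End Lift.
End TensorTheory.

Lemma tensor_map_comp (R : pzRingType) (X X' X'' : lmodType R^c)
    (Y Y' Y'' : lmodType R) (f : {linear X -> X'}) (f' : {linear X' -> X''})
    (g : {linear Y -> Y'}) (g' : {linear Y' -> Y''})
    (h : {linear X -> X''}) (k : {linear Y -> Y''}) :
  h =1 f' \o f -> k =1 g' \o g ->
  forall z, tensor_map f' g' (tensor_map f g z) = tensor_map h k z.
Proof.
move=> hE kE; apply: tensor_ext => [u v|u v|x y]; rewrite ?raddfB //=.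
by rewrite !tensor_mapE hE kE.
Qed.

Lemma tensor_map_id (R : pzRingType) (X : lmodType R^c) (Y : lmodType R)
    (f : {linear X -> X}) (g : {linear Y -> Y}) :
  f =1 id -> g =1 id -> tensor_map f g =1 id.
Proof.
move=> fE gE; apply: tensor_ext => [u v|u v|x y]; rewrite ?raddfB //.
by rewrite tensor_mapE fE gE.
Qed.

(** * Restriction and extension of scalars for bimodules *)

Section LeftRestriction.
Variables (R T : pzRingType) (f : {rmorphism R -> T}).

(** The vacuous [let] keeps [f] in the type, so that the scalar action along [f] can be a canonical
    instance. *)
Definition lres (W : lmodType T) : Type := let _ := f in W.
HB.instance Definition _ (W : lmodType T) := GRing.Zmodule.on (lres W).

Section Lmod.
Variable W : lmodType T.
Definition lres_scale (a : R) (w : lres W) : lres W := f a *: (w : W).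
Fact lres_scaleA a b w : lres_scale a (lres_scale b w) = lres_scale (a * b) w.
Proof. by rewrite /lres_scale scalerA rmorphM. Qed.
Fact lres_scale1 : left_id 1 lres_scale.
Proof. by move=> w; rewrite /lres_scale rmorph1 scale1r. Qed.
Fact lres_scaleDr : right_distributive lres_scale +%R.
Proof. by move=> a x y; apply: scalerDr. Qed.
Fact lres_scaleDl w : {morph lres_scale^~ w : a b / a + b}.
Proof. by move=> a b; rewrite /lres_scale rmorphD scalerDl. Qed.
HB.instance Definition _ := GRing.Zmodule_isLmodule.Build R (lres W)
  lres_scaleA lres_scale1 lres_scaleDr lres_scaleDl.
End Lmod.

Section Bimod.
Variables (S : pzRingType) (W : bimodType T S).
Definition lres_rscale (w : lres W) (b : S) : lres W := rscale (w : W) b.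
Fact lres_rscaleA x b c :
  lres_rscale (lres_rscale x b) c = lres_rscale x (b * c).
Proof. exact: rscaleA. Qed.
Fact lres_rscale1 x : lres_rscale x 1 = x.
Proof. exact: rscale1. Qed.
Fact lres_rscaleDl x y b :
  lres_rscale (x + y) b = lres_rscale x b + lres_rscale y b.
Proof. exact: rscaleDl. Qed.
Fact lres_rscaleDr x b c :
  lres_rscale x (b + c) = lres_rscale x b + lres_rscale x c.
Proof. exact: rscaleDr. Qed.
Fact lres_scale_rscale (a : R) x b :
  a *: lres_rscale x b = lres_rscale (a *: x) b.
Proof. exact: scale_rscale. Qed.
HB.instance Definition _ := Lmodule_isBimodule.Build R S (lres W)
  lres_rscaleA lres_rscale1 lres_rscaleDl lres_rscaleDr lres_scale_rscale.
End Bimod.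

End LeftRestriction.

Section RightRestriction.
Variables (S R T : pzRingType) (g : {rmorphism R -> T}) (W : bimodType S T).

Definition rres : Type := let _ := g in W.
HB.instance Definition _ := GRing.Lmodule.on rres.

Definition rres_rscale (w : rres) (b : R) : rres := rscale (w : W) (g b).
Fact rres_rscaleA x b c :
  rres_rscale (rres_rscale x b) c = rres_rscale x (b * c).
Proof. by rewrite /rres_rscale rscaleA rmorphM. Qed.
Fact rres_rscale1 x : rres_rscale x 1 = x.
Proof. by rewrite /rres_rscale rmorph1 rscale1. Qed.
Fact rres_rscaleDl x y b :
  rres_rscale (x + y) b = rres_rscale x b + rres_rscale y b.
Proof. exact: rscaleDl. Qed.
Fact rres_rscaleDr x b c :
  rres_rscale x (b + c) = rres_rscale x b + rres_rscale x c.
Proof. by rewrite /rres_rscale rmorphD rscaleDr. Qed.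
Fact rres_scale_rscale (a : S) x b :
  a *: rres_rscale x b = rres_rscale (a *: x) b.
Proof. exact: scale_rscale. Qed.
HB.instance Definition _ := Lmodule_isBimodule.Build S R rres
  rres_rscaleA rres_rscale1 rres_rscaleDl rres_rscaleDr rres_scale_rscale.

End RightRestriction.

Section RightModule.
Variables (S R : pzRingType) (V : bimodType S R).

Definition rmod : Type := V.
HB.instance Definition _ := GRing.Zmodule.on rmod.

Definition rmod_scale (a : R^c) (x : rmod) : rmod := rscale (x : V) (a : R).
Fact rmod_scaleA a b x : rmod_scale a (rmod_scale b x) = rmod_scale (a * b) x.
Proof. exact: rscaleA. Qed.
Fact rmod_scale1 : left_id 1 rmod_scale.
Proof. exact: rscale1. Qed.
Fact rmod_scaleDr : right_distributive rmod_scale +%R.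
Proof. by move=> a x y; apply: rscaleDl. Qed.
Fact rmod_scaleDl x : {morph rmod_scale^~ x : a b / a + b}.
Proof. by move=> a b; apply: rscaleDr. Qed.
HB.instance Definition _ := GRing.Zmodule_isLmodule.Build R^c rmod
  rmod_scaleA rmod_scale1 rmod_scaleDr rmod_scaleDl.

End RightModule.

Section BimodHom.
Variables R S : pzRingType.
Implicit Types X Y Z : bimodType R S.

Lemma bimod_hom_zmod X Y (f : X -> Y) : bimod_hom f -> zmod_morphism f.
Proof. by case=> /linear_zmod. Qed.

Lemma bimod_hom_scale X Y (f : X -> Y) :
  bimod_hom f -> forall a x, f (a *: x) = a *: f x.
Proof. by case=> /linear_scalable. Qed.

Lemma bimod_hom_rscale X Y (f : X -> Y) :
  bimod_hom f -> forall x b, f (rscale x b) = rscale (f x) b.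
Proof. by case. Qed.

Lemma bimod_hom_comp X Y Z (f : X -> Y) (g : Y -> Z) :
  bimod_hom f -> bimod_hom g -> bimod_hom (g \o f).
Proof.
move=> [fL fr] [gL gr]; split=> [a x y|x b] /=; first by rewrite fL gL.
by rewrite fr gr.
Qed.

Lemma bimod_hom_intro X Y (f : X -> Y) :
  zmod_morphism f -> (forall a x, f (a *: x) = a *: f x) ->
  (forall x b, f (rscale x b) = rscale (f x) b) -> bimod_hom f.
Proof. by move=> fB fZ fr; split=> //; apply: zmod_scalable_linear. Qed.

Lemma scale_zmod X (a : R) : zmod_morphism (fun x : X => a *: x).
Proof. by move=> x y; apply: scalerBr. Qed.

Lemma rscale_zmod X (b : S) : zmod_morphism (fun x : X => rscale x b).
Proof. by apply: zmod_morph_additive => x y; apply: rscaleDl. Qed.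

Lemma rscale_zmodr X (x : X) : zmod_morphism (fun b : S => rscale x b).
Proof. by apply: zmod_morph_additive => b c; apply: rscaleDr. Qed.

Lemma rscale_linear X (b : S) : linear (fun x : X => rscale x b).
Proof.
apply: zmod_scalable_linear => [|a x]; first exact: rscale_zmod.
by rewrite scale_rscale.
Qed.
Definition rscale_lin X (b : S) : {linear X -> X} :=
  linear_of (rscale_linear b).

Lemma lscale_linear X (a : R) :
  linear (fun x : rmod X => a *: (x : X) : rmod X).
Proof.
apply: zmod_scalable_linear => [|b x]; first exact: scale_zmod.
exact: scale_rscale.
Qed.
Definition lscale_lin X (a : R) : {linear rmod X -> rmod X} :=
  linear_of (lscale_linear a).

Lemma bimod_hom_rlinear X Y (f : X -> Y) :
  bimod_hom f -> linear (f : rmod X -> rmod Y).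
Proof.
move=> fH; apply: zmod_scalable_linear; first exact: bimod_hom_zmod.
by move=> b x; apply: bimod_hom_rscale.
Qed.

End BimodHom.

(** * Extension of scalars on the left *)

Section Induction.
Variables (R T : pzRingType) (f : {rmorphism R -> T}).

Fact lmul_linear (a : T) :
  linear (fun x : rrestr f => a * (x : T) : rrestr f).
Proof.
apply: zmod_scalable_linear => [x y|b x]; first exact: mulrBr.
exact: mulrA.
Qed.
Definition lmul_lin (a : T) : {linear rrestr f -> rrestr f} :=
  linear_of (lmul_linear a).

Definition ind (Y : lmodType R) : Type := tensor (rrestr f) Y.
HB.instance Definition _ (Y : lmodType R) := GRing.Zmodule.on (ind Y).

Section Lmod.
Variable Y : lmodType R.

Definition itens (x : T) (y : Y) : ind Y := tens (x : rrestr f) y.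

Definition ind_scale (a : T) (z : ind Y) : ind Y :=
  tensor_map (lmul_lin a) idfun z.

Fact ind_scaleA a b z : ind_scale a (ind_scale b z) = ind_scale (a * b) z.
Proof. by apply: tensor_map_comp => // x; apply/esym/mulrA. Qed.
Fact ind_scale1 : left_id 1 ind_scale.
Proof. by apply: tensor_map_id => // x; apply: mul1r. Qed.
Fact ind_scaleDr : right_distributive ind_scale +%R.
Proof. by move=> a x y; apply: raddfD. Qed.
Fact ind_scaleDl z : {morph ind_scale^~ z : a b / a + b}.
Proof.
move=> a b; move: z; apply: tensor_ext => [u v|u v|x y].
- exact: raddfB.
- by rewrite /ind_scale !raddfB opprD addrACA.
by rewrite /ind_scale !tensor_mapE /= mulrDl (zmod_morphD (tens_zmodl _)).
Qed.
HB.instance Definition _ := GRing.Zmodule_isLmodule.Build T (ind Y)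
  ind_scaleA ind_scale1 ind_scaleDr ind_scaleDl.

Lemma scale_itens (a x : T) (y : Y) : a *: itens x y = itens (a * x) y.
Proof. exact: tensor_mapE. Qed.

Lemma itens_scale (x : T) (r : R) (y : Y) :
  itens x (r *: y) = itens (x * f r) y.
Proof. exact/esym/tensZ. Qed.

Lemma itens1_scale (r : R) (y : Y) : itens 1 (r *: y) = f r *: itens 1 y.
Proof. by rewrite itens_scale scale_itens mul1r mulr1. Qed.

Lemma itens_zmodl (y : Y) : zmod_morphism (itens^~ y).
Proof. by move=> x x'; apply: (@tens_zmodl R (rrestr f) Y y x x'). Qed.

Lemma itens_zmodr (x : T) : zmod_morphism (itens x).
Proof. exact: tens_zmodr. Qed.

Lemma itensE (x : T) (y : Y) : itens x y = x *: itens 1 y.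
Proof. by rewrite scale_itens mulr1. Qed.

Lemma ind_ext (V : zmodType) (h k : ind Y -> V) :
  zmod_morphism h -> zmod_morphism k ->
  (forall x y, h (itens x y) = k (itens x y)) -> h =1 k.
Proof. exact: tensor_ext. Qed.

Lemma ind_ind (P : ind Y -> Prop) :
  (forall x y, P (itens x y)) -> (forall u v, P u -> P v -> P (u - v)) ->
  forall z, P z.
Proof. by move=> Pt PB z; apply: (@tensor_ind R (rrestr f) Y P). Qed.

Variables (W : lmodType T) (u : Y -> W).
Hypotheses (uB : zmod_morphism u) (uZ : forall r y, u (r *: y) = f r *: u y).

Definition ind_lift : ind Y -> W :=
  tensor_lift (fun (x : rrestr f) (y : Y) => (x : T) *: u y).

Fact ind_lift_rules :
  [/\ zmod_morphism ind_lift & forall x y, ind_lift (itens x y) = x *: u y].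
Proof.
have hBl y : zmod_morphism (fun x : rrestr f => (x : T) *: u y).
  by move=> x x'; apply: scalerBl.
have hBr (x : rrestr f) : zmod_morphism (fun y : Y => (x : T) *: u y).
  by move=> y y'; rewrite uB scalerBr.
have hZ (a : R) (x : rrestr f) y :
    (((a : R^c) *: x : rrestr f) : T) *: u y = (x : T) *: u (a *: y).
  by rewrite uZ scalerA.
split; first exact: tensor_lift_zmod.
by move=> x y; apply: (tensor_liftE hBl hBr hZ).
Qed.

Lemma ind_lift_zmod : zmod_morphism ind_lift.
Proof. by case: ind_lift_rules. Qed.

Lemma ind_liftE x y : ind_lift (itens x y) = x *: u y.
Proof. by case: ind_lift_rules. Qed.

Lemma ind_lift_scale a z : ind_lift (a *: z) = a *: ind_lift z.
Proof.
move: z; apply: ind_ext => [z z'|z z'|x y].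
- by rewrite scalerBr ind_lift_zmod.
- by rewrite ind_lift_zmod scalerBr.
by rewrite scale_itens !ind_liftE scalerA.
Qed.

Lemma ind_lift_linear : linear ind_lift.
Proof.
by apply: zmod_scalable_linear; [apply: ind_lift_zmod | apply: ind_lift_scale].
Qed.

End Lmod.

Section Map.
Variables (Y Y' : lmodType R) (g : {linear Y -> Y'}).

Definition ind_map : ind Y -> ind Y' :=
  tensor_map (idfun : {linear rrestr f -> rrestr f}) g.

Lemma ind_mapE x y : ind_map (itens x y) = itens x (g y).
Proof. exact: tensor_mapE. Qed.

Lemma ind_map_zmod : zmod_morphism ind_map.
Proof. by move=> u v; apply: raddfB. Qed.

Lemma ind_map_linear : linear ind_map.
Proof.
apply: zmod_scalable_linear; first exact: ind_map_zmod.
move=> a z; transitivity (tensor_map (lmul_lin a) g z).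
  exact: tensor_map_comp.
by apply/esym/tensor_map_comp.
Qed.

End Map.

Section Bimod.
Variables (S : pzRingType) (Y : bimodType R S).

Definition ind_rscale (z : ind Y) (b : S) : ind Y :=
  tensor_map idfun (rscale_lin Y b) z.

Fact ind_rscaleA x b c :
  ind_rscale (ind_rscale x b) c = ind_rscale x (b * c).
Proof. by apply: tensor_map_comp => // y; apply/esym/rscaleA. Qed.
Fact ind_rscale1 x : ind_rscale x 1 = x.
Proof. by apply: tensor_map_id => // y; apply: rscale1. Qed.
Fact ind_rscaleDl x y b :
  ind_rscale (x + y) b = ind_rscale x b + ind_rscale y b.
Proof. exact: raddfD. Qed.
Fact ind_rscaleDr x b c :
  ind_rscale x (b + c) = ind_rscale x b + ind_rscale x c.
Proof.
move: x; apply: tensor_ext => [u v|u v|x y].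
- exact: raddfB.
- by rewrite /ind_rscale !raddfB opprD addrACA.
by rewrite /ind_rscale !tensor_mapE /= rscaleDr (zmod_morphD (tens_zmodr _)).
Qed.
Fact ind_scale_rscale (a : T) (x : ind Y) b :
  a *: ind_rscale x b = ind_rscale (a *: x) b.
Proof.
transitivity (tensor_map (lmul_lin a) (rscale_lin Y b) x).
  exact: tensor_map_comp.
exact/esym/tensor_map_comp.
Qed.
HB.instance Definition _ := Lmodule_isBimodule.Build T S (ind Y)
  ind_rscaleA ind_rscale1 ind_rscaleDl ind_rscaleDr ind_scale_rscale.

Lemma rscale_itens (x : T) (y : Y) (b : S) :
  rscale (itens x y : ind Y) b = itens x (rscale y b).
Proof. exact: tensor_mapE. Qed.

Lemma ind_lift_hom (W : bimodType T S) (u : Y -> W) :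
  bimod_hom (u : Y -> lres f W) -> bimod_hom (ind_lift u : ind Y -> W).
Proof.
move=> uH; have uB := bimod_hom_zmod uH.
have uZ r y : u (r *: y) = f r *: u y by exact: (bimod_hom_scale uH).
split; first exact: ind_lift_linear.
move=> z b; move: z; apply: ind_ext => [z z'|z z'|x y].
- by rewrite (rscale_zmod _) ind_lift_zmod.
- by rewrite ind_lift_zmod // (rscale_zmod _).
rewrite rscale_itens !ind_liftE // -scale_rscale; congr (_ *: _).
exact: (bimod_hom_rscale uH).
Qed.

End Bimod.

Lemma ind_map_hom (S : pzRingType) (Y Y' : bimodType R S)
    (g : {linear Y -> Y'}) :
  (forall y b, g (rscale y b) = rscale (g y) b) ->
  bimod_hom (ind_map g : ind Y -> ind Y').
Proof.
move=> gr; split; first exact: ind_map_linear.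
move=> z b; move: z; apply: ind_ext => [z z'|z z'|x y].
- by rewrite (rscale_zmod _) ind_map_zmod.
- by rewrite ind_map_zmod (rscale_zmod _).
by rewrite rscale_itens !ind_mapE gr rscale_itens.
Qed.

(** Induction is left adjoint to restriction, which preserves surjections: a lift of the restricted
    map p |-> u(1 (x) p) extends back to the induced bimodule. *)
Lemma ind_projective (S : pzRingType) (P : bimodType R S) :
  projective_bimod P -> projective_bimod (ind P : bimodType T S).
Proof.
move=> Pproj X Y g u gH gS uH.
have [|//||h hH ghE] := Pproj (lres f X) (lres f Y) g (u \o itens 1).
- apply: bimod_hom_intro; first exact: bimod_hom_zmod gH.
    by move=> a x; apply: (bimod_hom_scale gH).
  by move=> x b; apply: (bimod_hom_rscale gH).
- apply: bimod_hom_intro.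
  + by move=> p q /=; rewrite itens_zmodr (bimod_hom_zmod uH).
  + by move=> a p /=; rewrite itens1_scale (bimod_hom_scale uH).
  + by move=> p b /=; rewrite -rscale_itens (bimod_hom_rscale uH).
have liH := ind_lift_hom hH; exists (ind_lift h : ind P -> X) => //.
apply: ind_ext => [z z'|z z'|x p].
- by rewrite (bimod_hom_zmod liH) (bimod_hom_zmod gH).
- exact: bimod_hom_zmod uH _ _.
have hZ r y : h (r *: y) = f r *: (h y : X) by exact: (bimod_hom_scale hH).
rewrite ind_liftE //; last exact: (bimod_hom_zmod hH).
by rewrite (bimod_hom_scale gH) ghE /= -(bimod_hom_scale uH) -itensE.
Qed.

End Induction.

Arguments ind_map {R T} f {Y Y'} g z.

Section Span.
Variables (R S : pzRingType) (X : bimodType R S) (m : nat) (e : 'I_m -> X).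

Definition bimod_span (x : X) : Prop := exists s : seq (R * 'I_m * S),
  x = \sum_(u <- s) rscale (u.1.1 *: e u.1.2) u.2.

Lemma bimod_span0 : bimod_span 0.
Proof. by exists [::]; rewrite big_nil. Qed.

Lemma bimod_spanD x y : bimod_span x -> bimod_span y -> bimod_span (x + y).
Proof. by move=> [s ->] [s' ->]; exists (s ++ s'); rewrite big_cat. Qed.

Lemma bimod_span_scale a x : bimod_span x -> bimod_span (a *: x).
Proof.
move=> [s ->]; exists [seq (a * u.1.1, u.1.2, u.2) | u <- s].
rewrite big_map scaler_sumr; apply: eq_bigr => u _.
by rewrite scale_rscale scalerA.
Qed.

Lemma bimod_spanN x : bimod_span x -> bimod_span (- x).
Proof. by rewrite -scaleN1r; apply: bimod_span_scale. Qed.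

Lemma bimod_spanB x y : bimod_span x -> bimod_span y -> bimod_span (x - y).
Proof. by move=> hx hy; apply/bimod_spanD/bimod_spanN. Qed.

Lemma bimod_span_rscale b x : bimod_span x -> bimod_span (rscale x b).
Proof.
move=> [s ->]; exists [seq (u.1, u.2 * b) | u <- s].
rewrite big_map (zmod_morph_sum (rscale_zmod b)).
by apply: eq_bigr => u _ /=; rewrite rscaleA.
Qed.

Lemma bimod_span_gen i : bimod_span (e i).
Proof. by exists [:: (1, i, 1)]; rewrite big_seq1 scale1r rscale1. Qed.

End Span.

Lemma ind_fg (R T S : pzRingType) (f : {rmorphism R -> T}) (P : bimodType R S) :
  fg_bimod P -> fg_bimod (ind f P).
Proof.
move=> [m [e eP]]; pose e' i : ind f P := itens f 1 (e i); exists m, e'.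
apply: (ind_ind (P := bimod_span e')) => [x y|u v]; last exact: bimod_spanB.
rewrite itensE; apply: bimod_span_scale; have [s ->] := eP y.
rewrite (zmod_morph_sum (itens_zmodr f 1)).
elim/big_ind: _ => [|u v|u _] /=; first exact: bimod_span0.
  exact: bimod_spanD.
rewrite -rscale_itens itens1_scale.
exact/bimod_span_rscale/bimod_span_scale/(bimod_span_gen e').
Qed.

(** * Extension of scalars on the right *)

Section RightInduction.
Variables (S R T : pzRingType) (g : {rmorphism R -> T}).

Definition rind (V : bimodType S R) : Type := tensor (rmod V) (lres g T^o).
HB.instance Definition _ V := GRing.Zmodule.on (rind V).

Section Bimod.
Variable V : bimodType S R.

Definition rtens (v : V) (x : T) : rind V :=
  tens (v : rmod V) (x : lres g T^o).

Definition rind_scale (a : S) (z : rind V) : rind V :=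
  tensor_map (lscale_lin V a) idfun z.

Fact rind_scaleA a b z : rind_scale a (rind_scale b z) = rind_scale (a * b) z.
Proof. by apply: tensor_map_comp => // x; apply/esym/(@scalerA S V). Qed.
Fact rind_scale1 : left_id 1 rind_scale.
Proof. by apply: tensor_map_id => // x; apply: (@scale1r S V). Qed.
Fact rind_scaleDr : right_distributive rind_scale +%R.
Proof. by move=> a x y; apply: raddfD. Qed.
Fact rind_scaleDl z : {morph rind_scale^~ z : a b / a + b}.
Proof.
move=> a b; move: z; apply: tensor_ext => [u v|u v|x y].
- exact: raddfB.
- by rewrite /rind_scale !raddfB opprD addrACA.
by rewrite /rind_scale !tensor_mapE /= scalerDl (zmod_morphD (tens_zmodl _)).
Qed.
HB.instance Definition _ := GRing.Zmodule_isLmodule.Build S (rind V)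
  rind_scaleA rind_scale1 rind_scaleDr rind_scaleDl.

Definition rind_rscale (z : rind V) (b : T) : rind V :=
  tensor_map idfun (rscale_lin (lres g T^o) b) z.

Fact rind_rscaleA x b c :
  rind_rscale (rind_rscale x b) c = rind_rscale x (b * c).
Proof. by apply: tensor_map_comp => // y; apply/esym/rscaleA. Qed.
Fact rind_rscale1 x : rind_rscale x 1 = x.
Proof. by apply: tensor_map_id => // y; apply: rscale1. Qed.
Fact rind_rscaleDl x y b :
  rind_rscale (x + y) b = rind_rscale x b + rind_rscale y b.
Proof. exact: raddfD. Qed.
Fact rind_rscaleDr x b c :
  rind_rscale x (b + c) = rind_rscale x b + rind_rscale x c.
Proof.
move: x; apply: tensor_ext => [u v|u v|x y].
- exact: raddfB.
- by rewrite /rind_rscale !raddfB opprD addrACA.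
by rewrite /rind_rscale !tensor_mapE /= rscaleDr (zmod_morphD (tens_zmodr _)).
Qed.
Fact rind_scale_rscale (a : S) (x : rind V) b :
  a *: rind_rscale x b = rind_rscale (a *: x) b.
Proof.
transitivity (tensor_map (lscale_lin V a) (rscale_lin (lres g T^o) b) x).
  exact: tensor_map_comp.
exact/esym/tensor_map_comp.
Qed.
HB.instance Definition _ := Lmodule_isBimodule.Build S T (rind V)
  rind_rscaleA rind_rscale1 rind_rscaleDl rind_rscaleDr rind_scale_rscale.

Lemma scale_rtens (a : S) (v : V) (x : T) : a *: rtens v x = rtens (a *: v) x.
Proof. exact: tensor_mapE. Qed.

Lemma rscale_rtens (v : V) (x b : T) : rscale (rtens v x) b = rtens v (x * b).
Proof. exact: tensor_mapE. Qed.

Lemma rtens_rscale (v : V) (r : R) (x : T) :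
  rtens (rscale v r) x = rtens v (g r * x).
Proof. by apply: (@tensZ R (rmod V) (lres g T^o) r v x). Qed.

Lemma rtens1_rscale (v : V) (r : R) :
  rtens (rscale v r) 1 = rscale (rtens v 1) (g r).
Proof. by rewrite rtens_rscale rscale_rtens mul1r mulr1. Qed.

Lemma rtens_zmodl (x : T) : zmod_morphism (rtens^~ x).
Proof. by move=> v v'; apply: (@tens_zmodl R (rmod V) (lres g T^o) x v v'). Qed.

Lemma rtens_zmodr (v : V) : zmod_morphism (rtens v).
Proof. by move=> x x'; apply: (@tens_zmodr R (rmod V) (lres g T^o) v x x'). Qed.

Lemma rtensE (v : V) (x : T) : rtens v x = rscale (rtens v 1) x.
Proof. by rewrite rscale_rtens mul1r. Qed.

Lemma rind_ext (W : zmodType) (h k : rind V -> W) :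
  zmod_morphism h -> zmod_morphism k ->
  (forall v x, h (rtens v x) = k (rtens v x)) -> h =1 k.
Proof.
by move=> hB kB hk; apply: (@tensor_ext R (rmod V) (lres g T^o) W h k).
Qed.

Lemma rind_ind (P : rind V -> Prop) :
  (forall v x, P (rtens v x)) -> (forall u v, P u -> P v -> P (u - v)) ->
  forall z, P z.
Proof.
by move=> Pt PB z; apply: (@tensor_ind R (rmod V) (lres g T^o) P).
Qed.

Variables (W : bimodType S T) (u : V -> W).
Hypothesis uH : bimod_hom (u : V -> rres g W).

Definition rind_lift : rind V -> W :=
  tensor_lift (fun (v : rmod V) (x : lres g T^o) => rscale (u v) (x : T)).

Fact rind_lift_rules :
  [/\ zmod_morphism rind_lift &
      forall v x, rind_lift (rtens v x) = rscale (u v) x].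
Proof.
have hBl (x : lres g T^o) :
    zmod_morphism (fun v : rmod V => rscale (u v) (x : T)).
  by move=> v v'; rewrite (bimod_hom_zmod uH) (rscale_zmod (x : T)).
have hBr (v : rmod V) :
    zmod_morphism (fun x : lres g T^o => rscale (u v) (x : T)).
  by move=> x x'; apply: (rscale_zmodr (u v)).
have hZ (a : R) (v : rmod V) (x : lres g T^o) :
    rscale (u ((a : R^c) *: v)) (x : T) = rscale (u v) (a *: x : T).
  transitivity (rscale (rscale (u v) (g a)) x); last exact: rscaleA.
  by congr rscale; apply: (bimod_hom_rscale uH).
split; first exact: tensor_lift_zmod.
by move=> v x; apply: (tensor_liftE hBl hBr hZ).
Qed.

Lemma rind_liftE v x : rind_lift (rtens v x) = rscale (u v) x.
Proof. by case: rind_lift_rules. Qed.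

Lemma rind_lift_hom : bimod_hom (rind_lift : rind V -> W).
Proof.
have [rlB _] := rind_lift_rules.
apply: bimod_hom_intro => // [a z|z b]; move: z;
  apply: rind_ext => [z z'|z z'|v x].
- by rewrite scalerBr rlB.
- by rewrite rlB scalerBr.
- rewrite scale_rtens !rind_liftE scale_rscale; congr rscale.
  exact: (bimod_hom_scale uH).
- by rewrite (rscale_zmod _) rlB.
- by rewrite rlB (rscale_zmod _).
by rewrite rscale_rtens !rind_liftE rscaleA.
Qed.

End Bimod.

Section Map.
Variables V V' : bimodType S R.

(* Stated for right linear maps because the maps splitting a bimodule resolution
   are not left linear. *)
Definition rind_map (h : {linear rmod V -> rmod V'}) : rind V -> rind V' :=
  tensor_map h (idfun : {linear lres g T^o -> lres g T^o}).

Lemma rind_mapE h v x : rind_map h (rtens v x) = rtens (h v) x.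
Proof. exact: tensor_mapE. Qed.

Lemma rind_map_zmod h : zmod_morphism (rind_map h).
Proof. by move=> x y; apply: raddfB. Qed.

Lemma rind_map_hom (h : V -> V') (hH : bimod_hom h) :
  bimod_hom (rind_map (linear_of (bimod_hom_rlinear hH)) : rind V -> rind V').
Proof.
apply: bimod_hom_intro; first exact: rind_map_zmod.
  move=> a z; move: z; apply: rind_ext => [z z'|z z'|v x].
  - by rewrite scalerBr rind_map_zmod.
  - by rewrite rind_map_zmod scalerBr.
  by rewrite scale_rtens !rind_mapE scale_rtens /= (bimod_hom_scale hH).
move=> z b; move: z; apply: rind_ext => [z z'|z z'|v x].
- by rewrite (rscale_zmod _) rind_map_zmod.
- by rewrite rind_map_zmod (rscale_zmod _).
by rewrite rscale_rtens !rind_mapE rscale_rtens.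
Qed.

End Map.

Lemma rind_projective (P : bimodType S R) :
  projective_bimod P -> projective_bimod (rind P : bimodType S T).
Proof.
move=> Pproj X Y k u kH kS uH.
have [|//||h hH khE] :=
  Pproj (rres g X) (rres g Y) k (u \o (fun p => rtens p 1)).
- apply: bimod_hom_intro; first exact: bimod_hom_zmod kH.
    by move=> a x; apply: (bimod_hom_scale kH).
  by move=> x b; apply: (bimod_hom_rscale kH).
- apply: bimod_hom_intro.
  + by move=> p q /=; rewrite rtens_zmodl (bimod_hom_zmod uH).
  + by move=> a p /=; rewrite -scale_rtens (bimod_hom_scale uH).
  + by move=> p b /=; rewrite rtens1_rscale (bimod_hom_rscale uH).
have liH := rind_lift_hom hH; exists (rind_lift h : rind P -> X) => //.
apply: rind_ext => [z z'|z z'|p x].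
- by rewrite (bimod_hom_zmod liH) (bimod_hom_zmod kH).
- exact: bimod_hom_zmod uH _ _.
rewrite rind_liftE // (bimod_hom_rscale kH) khE /=.
by rewrite -(bimod_hom_rscale uH) -rtensE.
Qed.

Lemma rind_fg (P : bimodType S R) : fg_bimod P -> fg_bimod (rind P).
Proof.
move=> [m [e eP]]; pose e' i : rind P := rtens (e i) 1; exists m, e'.
apply: (rind_ind (P := bimod_span e')) => [v x|u v]; last exact: bimod_spanB.
rewrite rtensE; apply: bimod_span_rscale; have [s ->] := eP v.
rewrite (zmod_morph_sum (rtens_zmodl 1)).
elim/big_ind: _ => [|u w|u _] /=; first exact: bimod_span0.
  exact: bimod_spanD.
rewrite rtens1_rscale -scale_rtens.
exact/bimod_span_rscale/bimod_span_scale/(bimod_span_gen e').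
Qed.

End RightInduction.

Arguments rind_map {S R T} g {V V'} h z.

(** * Right splitting of bimodule resolutions *)

Section LinearImage.
Variables (R : pzRingType) (X Y : lmodType R) (g : {linear X -> Y}).

Definition in_limage : {pred Y} := fun y => `[< exists x, g x = y >].

Fact in_limage_closed : submod_closed in_limage.
Proof.
split=> [|a _ _ /asboolP[x <-] /asboolP[y <-]]; apply/asboolP.
  by exists 0; apply: raddf0.
by exists (a *: x + y); rewrite linearP.
Qed.
HB.instance Definition _ :=
  GRing.isSubmodClosed.Build R Y in_limage in_limage_closed.

(** Projectivity lifts along surjections and flatness speaks of injections; factoring through the
    image, as a module in its own right, extends both to arbitrary maps. *)
Definition limage : Type := {y : Y | in_limage y}.
HB.instance Definition _ := SubChoice.on limage.
HB.instance Definition _ := [SubChoice_isSubLmodule of limage by <:].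

Lemma in_limageP x : in_limage (g x).
Proof. by apply/asboolP; exists x. Qed.

Definition limage_in (x : X) : limage := exist _ (g x) (in_limageP x).

Lemma limage_in_linear : linear limage_in.
Proof. by move=> a x y; apply: val_inj; rewrite /= linearP. Qed.

Lemma limage_in_surj : surj limage_in.
Proof.
by case=> y yP; have /asboolP[x gx] := yP; exists x; apply: val_inj.
Qed.

End LinearImage.

Section BimoduleImage.
Variables (R S : pzRingType) (X Y : bimodType R S) (g : X -> Y).
Hypothesis gH : bimod_hom g.

Definition bimage : Type := limage (linear_of gH.1).
HB.instance Definition _ := GRing.Lmodule.on bimage.

Fact bimage_rscale_subproof (y : bimage) (b : S) :
  in_limage (linear_of gH.1) (rscale (val y) b).
Proof.
have /asboolP[x <-] := valP y; apply/asboolP.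
by exists (rscale x b); apply: gH.2.
Qed.

Definition bimage_rscale (y : bimage) (b : S) : bimage :=
  exist _ (rscale (val y) b) (bimage_rscale_subproof y b).

Fact bimage_rscaleA x b c :
  bimage_rscale (bimage_rscale x b) c = bimage_rscale x (b * c).
Proof. by apply: val_inj; apply: rscaleA. Qed.
Fact bimage_rscale1 x : bimage_rscale x 1 = x.
Proof. by apply: val_inj; apply: rscale1. Qed.
Fact bimage_rscaleDl x y b :
  bimage_rscale (x + y) b = bimage_rscale x b + bimage_rscale y b.
Proof. by apply: val_inj; apply: rscaleDl. Qed.
Fact bimage_rscaleDr x b c :
  bimage_rscale x (b + c) = bimage_rscale x b + bimage_rscale x c.
Proof. by apply: val_inj; apply: rscaleDr. Qed.
Fact bimage_scale_rscale (a : R) (x : bimage) b :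
  a *: bimage_rscale x b = bimage_rscale (a *: x) b.
Proof. by apply: val_inj; apply: scale_rscale. Qed.
HB.instance Definition _ := Lmodule_isBimodule.Build R S bimage
  bimage_rscaleA bimage_rscale1 bimage_rscaleDl bimage_rscaleDr
  bimage_scale_rscale.

(** The last hypothesis puts the values of [f] into the image of [g], and [g] is surjective onto
    that image. *)
Lemma projective_lift (P : bimodType R S) (f : P -> Y) :
  projective_bimod P -> bimod_hom f -> (forall p, exists x, g x = f p) ->
  exists2 h : P -> X, bimod_hom h & forall p, g (h p) = f p.
Proof.
move=> Pproj fH fg; pose g' : X -> bimage := limage_in (linear_of gH.1).
have fP p : in_limage (linear_of gH.1) (f p) by apply/asboolP/fg.
pose f' p : bimage := exist _ (f p) (fP p).
have [|||h hH gh] := Pproj X bimage g' f'.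
- split=> [|x b]; first exact: limage_in_linear.
  by apply: val_inj; apply: gH.2.
- exact: limage_in_surj.
- split=> [a x y|x b]; apply: val_inj; [exact: fH.1 | exact: fH.2].
by exists h => // p; have /(congr1 val) := gh p.
Qed.

End BimoduleImage.

(** * Coinduction and right linear lifts from projective bimodules *)

Section Coinduction.
Variables (N : monoidType) (R S : pzRingType) (W : bimodType R S).

(* The coinduced bimodule Hom_Z(ZN, W), as functions on the basis N. *)
Definition coind : Type := N -> W.
HB.instance Definition _ := GRing.Zmodule.on coind.

(** Right translation of the argument, extended additively in [a]. The left action on [W] does not
    enter, which is why maps that are merely right linear can be fed into the construction. *)
Definition coind_scale (a : monoid_ring N) (h : coind) : coind :=
  fun x => mlift (fun k => h (x * k)%g) a.

Lemma coind_scaleU k h x : coind_scale << k >> h x = h (x * k)%g.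
Proof. exact: mliftU. Qed.

Fact coind_scaleDl h : {morph coind_scale^~ h : a b / a + b}.
Proof. by move=> a b; apply/funext => x; apply: raddfD. Qed.
Fact coind_scaleBl h : zmod_morphism (coind_scale^~ h).
Proof. exact/zmod_morph_additive/coind_scaleDl. Qed.
Fact coind_scaleDr : right_distributive coind_scale +%R.
Proof.
move=> a h k; apply/funext => x; move: a; apply: malg_ext.
- by move=> a b; apply: raddfB.
- move=> a b; rewrite (coind_scaleBl h) (coind_scaleBl k) /=.
  by rewrite opprD addrACA.
by move=> l; rewrite [RHS]/GRing.add /= !coind_scaleU.
Qed.
Fact coind_scaleA a b h :
  coind_scale a (coind_scale b h) = coind_scale (a * b) h.
Proof.
move: a; apply: malg_ext => [a a'|a a'|k].
- exact: coind_scaleBl.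
- by rewrite mulrBl coind_scaleBl.
move: b; apply: malg_ext => [b b'|b b'|l].
- by rewrite coind_scaleBl (zmod_morph_additive (coind_scaleDr _)).
- by rewrite mulrBr coind_scaleBl.
apply/funext => x; rewrite [_ * _]mr_mulUU !coind_scaleU mulgA //.
Qed.
Fact coind_scale1 : left_id 1 coind_scale.
Proof. by move=> h; apply/funext => x; rewrite coind_scaleU mulg1. Qed.
HB.instance Definition _ := GRing.Zmodule_isLmodule.Build (monoid_ring N) coind
  coind_scaleA coind_scale1 coind_scaleDr coind_scaleDl.

Definition coind_rscale (h : coind) (b : S) : coind := fun x => rscale (h x) b.

Fact coind_rscaleA x b c :
  coind_rscale (coind_rscale x b) c = coind_rscale x (b * c).
Proof. by apply/funext => k; apply: rscaleA. Qed.
Fact coind_rscale1 x : coind_rscale x 1 = x.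
Proof. by apply/funext => k; apply: rscale1. Qed.
Fact coind_rscaleDl x y b :
  coind_rscale (x + y) b = coind_rscale x b + coind_rscale y b.
Proof. by apply/funext => k; apply: rscaleDl. Qed.
Fact coind_rscaleDr x b c :
  coind_rscale x (b + c) = coind_rscale x b + coind_rscale x c.
Proof. by apply/funext => k; apply: rscaleDr. Qed.
Fact coind_scale_rscale (a : monoid_ring N) x b :
  a *: coind_rscale x b = coind_rscale (a *: x) b.
Proof.
apply/funext => k; rewrite [RHS](zmod_morph_sum (rscale_zmod b)).
apply: eq_bigr => l _; exact/esym/(raddfMz (additive_of (rscale_zmod b))).
Qed.
HB.instance Definition _ := Lmodule_isBimodule.Build (monoid_ring N) S coind
  coind_rscaleA coind_rscale1 coind_rscaleDl coind_rscaleDr coind_scale_rscale.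

End Coinduction.

Section RightProjective.
Variables (N : monoidType) (S : pzRingType).
Let R := monoid_ring N.

(** Coinduction is right adjoint to forgetting the left action: a right linear [f] corresponds to
    the bimodule map sending p to k |-> f(k p), and evaluating its lift at 1 returns a right linear
    lift of [f]. Values of this bimodule map are functions on the set [N], so preimages under
    composition with [g] are chosen pointwise. *)
Lemma projective_right_lift (P : bimodType R S) (X Y : bimodType R S)
    (g : X -> Y) (f : P -> Y) :
  projective_bimod P -> bimod_hom g -> linear (f : rmod P -> rmod Y) ->
  (forall p, exists x, g x = f p) ->
  exists2 h : P -> X, linear (h : rmod P -> rmod X) & forall p, g (h p) = f p.
Proof.
move=> Pproj gH fL fg; have fB : zmod_morphism f := linear_zmod fL.
have gB := bimod_hom_zmod gH.
pose cg (u : coind N X) : coind N Y := g \o u.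
pose cf (p : P) : coind N Y := fun k => f ((<< k >> : R) *: p).
have cgH : bimod_hom cg.
  apply: bimod_hom_intro => [u v|a u|u b]; apply/funext => k.
  - exact: gB.
  - rewrite /cg /= (zmod_morph_sum gB); apply: eq_bigr => l _.
    exact: (raddfMz (additive_of gB)).
  - exact: gH.2.
have cfH : bimod_hom cf.
  apply: bimod_hom_intro => [p q|a p|p b]; apply/funext => k.
  - by rewrite /cf scalerBr fB.
  - move: a; apply: malg_ext => [a a'|a a'|l].
    + by rewrite /cf scalerBl scalerBr fB.
    + by rewrite scalerBl.
    by rewrite [RHS]coind_scaleU /cf scalerA [_ * _]mr_mulUU.
  - rewrite /cf scale_rscale; exact: (linear_scalable fL).
have [p|h hH hE] := projective_lift cgH Pproj cfH.
  have /choice[u uE] : forall k : N, exists x, g x = cf p k.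
    by move=> k; apply: fg.
  by exists u; apply/funext.
exists (fun p => h p 1%g) => [|p]; last first.
  have /(congr1 (fun u => u 1%g)) := hE p.
  by rewrite /cg /= => ->; rewrite /cf scale1r.
apply: zmod_scalable_linear => [p q|b p]; first by rewrite (bimod_hom_zmod hH).
by rewrite [h _]hH.2.
Qed.

End RightProjective.

Section RightSplitting.
Variable N : monoidType.
Let R := monoid_ring N.
Variables (P : nat -> bimodType R R) (d : forall i, P i.+1 -> P i).
Arguments d : clear implicits.
Variable aug : P 0%N -> R^o.
Hypothesis res : projective_resolution d aug.

Let dB i : zmod_morphism (d i) := bimod_hom_zmod (res_d_hom res i).
Let dL i : linear (d i : rmod (P i.+1) -> rmod (P i)) :=
  bimod_hom_rlinear (res_d_hom res i).
Let dd i y : d i (d i.+1 y) = 0.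
Proof. by apply/(res_exactS res); exists y. Qed.

(** As a right module the regular bimodule is free on 1, so a preimage [p1] of 1 splits the
    augmentation. The difference p - p1 aug(p) is killed by [aug] and therefore lifts through the
    first differential. *)
Lemma right_split0 : exists (p1 : P 0%N) (s : P 0%N -> P 1%N),
  [/\ aug p1 = 1, linear (s : rmod (P 0%N) -> rmod (P 1%N)) &
      forall p, d 0 (s p) = p - rscale p1 (aug p : R)].
Proof.
have augH := res_aug_hom res; have augB := bimod_hom_zmod augH.
have [p1 p1E] := res_aug_surj res 1.
have eL : linear
    (fun p : rmod (P 0%N) => p - rscale p1 (aug p : R) : rmod (P 0%N)).
  apply: zmod_scalable_linear => [p q|b p].
    by rewrite augB (rscale_zmodr p1) !opprD addrACA.
  have -> : aug (b *: p) = (aug p : R) * (b : R) by exact: augH.2.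
  by rewrite scalerBr; congr (_ - _); rewrite -rscaleA.
have [p|s sL sE] := projective_right_lift (res_projective res (i := 0))
  (res_d_hom res 0) eL; last by exists p1, s.
apply/(res_exact0 res); rewrite augB augH.2 p1E.
by apply/eqP; rewrite subr_eq0; apply/eqP/esym/mul1r.
Qed.

(** The induction carries only d s d = d. This makes p - s(d p) a cycle, so it lifts through the
    next differential, and the lift [s'] again satisfies d s' d = d. A separate pair [s], [s'] for
    each degree is all that exactness there requires. *)
Lemma right_splitS i : exists (s : P i -> P i.+1) (s' : P i.+1 -> P i.+2),
  [/\ linear (s : rmod (P i) -> rmod (P i.+1)),
      linear (s' : rmod (P i.+1) -> rmod (P i.+2)) &
      forall p, d i.+1 (s' p) = p - s (d i p)].
Proof.
suff [s sL ds] : exists2 s : P i -> P i.+1,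
    linear (s : rmod (P i) -> rmod (P i.+1)) &
    forall y, d i (s (d i y)) = d i y.
  have sB : zmod_morphism s := linear_zmod sL.
  have eL : linear (fun p : rmod (P i.+1) => p - s (d i p) : rmod (P i.+1)).
    move=> a x y; rewrite dL sL scalerBr opprD addrACA //.
  have [p|s' s'L s'E] := projective_right_lift (res_projective res (i := i.+1))
    (res_d_hom res i.+1) eL; last by exists s, s'.
  by apply/(res_exactS res); rewrite dB ds subrr.
elim: i => [|i [s sL ds]].
  have [p1 [s [_ sL sE]]] := right_split0; exists s => // y; rewrite sE.
  have -> : aug (d 0 y) = 0 by apply/(res_exact0 res); exists y.
  by rewrite (zmod_morph0 (rscale_zmodr p1)) subr0.
have sB : zmod_morphism s := linear_zmod sL.
have eL : linear (fun p : rmod (P i.+1) => p - s (d i p) : rmod (P i.+1)).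
  by move=> a x y; rewrite dL sL scalerBr opprD addrACA.
have [p|s' s'L s'E] := projective_right_lift (res_projective res (i := i.+1))
  (res_d_hom res i.+1) eL; first by apply/(res_exactS res); rewrite dB ds subrr.
by exists s' => // y; rewrite s'E dd (zmod_morph0 sB) subr0.
Qed.

End RightSplitting.

(** * Resolutions induced on the right *)

Section RightInducedResolution.
Variables (N : monoidType) (T : pzRingType).
Let R := monoid_ring N.
Variable g : {rmorphism R -> T}.
Variables (P : nat -> bimodType R R) (d : forall i, P i.+1 -> P i).
Arguments d : clear implicits.
Variable aug : P 0%N -> R^o.
Hypothesis res : projective_resolution d aug.

Let daug (p : P 0%N) : lres g T^o := g (aug p).

Let daug_hom : bimod_hom (daug : P 0%N -> rres g (lres g T^o)).
Proof.
have augH := res_aug_hom res.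
apply: bimod_hom_intro => [p q|a p|p b].
- by rewrite /daug (bimod_hom_zmod augH) rmorphB.
- rewrite /daug (bimod_hom_scale augH); exact: (rmorphM g a (aug p)).
by rewrite /daug (bimod_hom_rscale augH); apply: (rmorphM g (aug p) b).
Qed.

(** The right linear homotopy survives tensoring with [T] on the right: z = d(s z) + p1 (x) aug(z)
    in degree 0 and z = d(s' z) + s(d z) above, so cycles are boundaries. The bimodule resolved is R
    (x)_R T, written directly as [lres g T^o]. *)
Lemma rind_resolution : projective_resolution
  (P := fun i => rind g (P i))
  (fun i => rind_map g (linear_of (bimod_hom_rlinear (res_d_hom res i))))
  (rind_lift daug).
Proof.
have augH := res_aug_hom res.
have lH := rind_lift_hom daug_hom; have lB := bimod_hom_zmod lH.
have lE p x : rind_lift daug (rtens g p x) = g (aug p) * x.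
  exact: (rind_liftE daug_hom).
have dd i y : d i (d i.+1 y) = 0 by apply/(res_exactS res); exists y.
have [p1 [s0 [p1E s0L ds0]]] := right_split0 res.
split.
- by move=> i; apply/rind_projective/(res_projective res).
- exact: lH.
- by move=> i; apply: rind_map_hom.
- by move=> x; exists (rtens g p1 x); rewrite lE p1E rmorph1 mul1r.
- move=> z; split=> [z0|[w <-]]; last first.
    move: w; apply: rind_ext => [w w'|w w'|p x].
    + by rewrite rind_map_zmod lB.
    + by rewrite subrr.
    rewrite rind_mapE lE.
    have -> : aug (d 0 p) = 0 by apply/(res_exact0 res); exists p.
    by rewrite rmorph0 mul0r.
  exists (rind_map g (linear_of s0L) z).
  (* The subtracted zero becomes [p1] tensored with the augmentation of [z]. What remains is the
     homotopy identity, which holds for every [z] and can be checked on pure tensors. *)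
  rewrite -[RHS]subr0 -(zmod_morph0 (rtens_zmodr g p1)) -z0.
  move: z {z0}; apply: rind_ext => [z z'|z z'|p x].
  + by rewrite !rind_map_zmod.
  + by rewrite lB rtens_zmodr !opprD addrACA.
  rewrite !rind_mapE lE /= ds0 (rtens_zmodl g x); congr (_ - _).
  by rewrite rtens_rscale.
move=> i z; split=> [z0|[w <-]]; last first.
  move: w; apply: rind_ext => [w w'|w w'|p x].
  + by rewrite !rind_map_zmod.
  + by rewrite subrr.
  by rewrite !rind_mapE /= dd (zmod_morph0 (rtens_zmodl g x)).
have [s [s' [sL s'L ds']]] := right_splitS res i.
exists (rind_map g (linear_of s'L) z).
rewrite -[RHS]subr0 -(zmod_morph0 (rind_map_zmod (g := g) (linear_of sL))) -z0.
move: z {z0}; apply: rind_ext => [z z'|z z'|p x].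
+ by rewrite !rind_map_zmod.
+ by rewrite !rind_map_zmod !opprD addrACA.
by rewrite !rind_mapE /= ds' (rtens_zmodl g x).
Qed.

End RightInducedResolution.

Local Open Scope quotient_scope.

(** * Exactness of induction along a flat ring map *)

Section FlatExactness.
Variables (R T : pzRingType) (f : {rmorphism R -> T}).

(** A set-theoretic section [s] of [q] defines a balanced map into the cokernel [C] of the map
    induced by [d]. Composed with the map induced by [q] it is the projection onto [C], so whatever
    [q] kills is zero in [C]. *)
Lemma ind_right_exact (Y1 Y0 Y : lmodType R) (d : {linear Y1 -> Y0})
    (q : {linear Y0 -> Y}) :
  surj q -> (forall y, q y = 0 -> exists x, d x = y) ->
  forall z, ind_map f q z = 0 -> exists w, ind_map f d w = z.
Proof.
move=> qS qd z qz0.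
pose G w := exists v, w = ind_map f d v.
pose C : zmodType := Quotient.quot (in_gen_subgroup G).
(* The image is already a subgroup, so passing to the generated one adds nothing to what the
   quotient kills. *)
have GE w : gen_subgroup G w -> G w.
  elim=> [//||_ _ _ [u ->] _ [v ->]].
    by exists 0; rewrite (zmod_morph0 (ind_map_zmod (f := f) d)).
  by exists (u - v); rewrite ind_map_zmod.
pose p w : C := \pi w.
have pB : zmod_morphism p by move=> u v; rewrite /p !piE.
have p0 w : p w = 0 <-> G w.
  split=> [pw0|Gw].
    apply/GE; have : p w = p 0 by rewrite pw0 (zmod_morph0 pB).
    by move/eqP; rewrite -Quotient.idealrBE subr0 => /asboolP.
  rewrite -(zmod_morph0 pB).
  apply/eqP; rewrite -Quotient.idealrBE subr0.
  exact/asboolP/gen_subgroup_incl.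
have [s sE] := choice qS.
(* Modulo the image of [d] the choice of preimage is immaterial; this makes a section that is a mere
   function additive and balanced. *)
have sP x y y' : q y = y' -> p (itens f x (s y')) = p (itens f x y).
  move=> <-; apply/eqP; rewrite -subr_eq0 -pB; apply/eqP/p0.
  have [|v dv] := qd (s (q y) - y); first by rewrite linearB /= sE subrr.
  by exists (itens f x v); rewrite ind_mapE dv -itens_zmodr.
pose h (x : rrestr f) (y : Y) : C := p (itens f x (s y)).
have hBl y : zmod_morphism (h^~ y).
  by move=> x x'; rewrite /h -pB -itens_zmodl.
have hBr x : zmod_morphism (h x).
  move=> y y'; rewrite /h -pB -itens_zmodr; apply: sP.
  by rewrite linearB /= !sE.
have hZ (a : R) (x : rrestr f) y : h ((a : R^c) *: x) y = h x (a *: y).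
  rewrite /h (sP x (a *: s y)) ?itens_scale //.
  by rewrite linearZ_LR sE.
suff: tensor_lift h (ind_map f q z) = p z.
  rewrite qz0 (zmod_morph0 (tensor_lift_zmod hBl hBr hZ)) => /esym/p0.
  by case=> v ->; exists v.
move: z {qz0}; apply: ind_ext => // [u v|x y].
  by rewrite ind_map_zmod (tensor_lift_zmod hBl hBr hZ).
by rewrite ind_mapE (tensor_liftE hBl hBr hZ); apply: sP.
Qed.

(** Factor [q] through its image: flatness keeps the inclusion of the image injective, and right
    exactness handles the surjection onto it. *)
Lemma ind_flat_exact (Y1 Y0 Y : lmodType R) (d : {linear Y1 -> Y0})
    (q : {linear Y0 -> Y}) :
  flat_right (rrestr f) -> (forall y, q y = 0 -> exists x, d x = y) ->
  forall z, ind_map f q z = 0 -> exists w, ind_map f d w = z.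
Proof.
move=> flat qd z qz0.
pose q' := linear_of (limage_in_linear q).
apply: (ind_right_exact (q := q')) => [|y /(congr1 val) /qd //|].
  exact: limage_in_surj.
pose i : {linear limage q -> Y} := val.
apply: (flat _ _ i val_inj); rewrite raddf0 -[RHS]qz0.
exact: tensor_map_comp.
Qed.

Lemma ind_surj (Y Y' : lmodType R) (g : {linear Y -> Y'}) :
  surj g -> surj (ind_map f g).
Proof.
move=> gS; apply: ind_ind => [x y|_ _ [u <-] [v <-]].
  by have [y' <-] := gS y; exists (itens f x y'); apply: ind_mapE.
by exists (u - v); apply: ind_map_zmod.
Qed.

End FlatExactness.

Section InducedResolution.
Variables (R T S : pzRingType) (f : {rmorphism R -> T}) (V : bimodType R S).
Variables (P : nat -> bimodType R S) (d : forall i, P i.+1 -> P i).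
Arguments d : clear implicits.
Variable aug : P 0%N -> V.
Hypothesis res : projective_resolution d aug.

Lemma ind_resolution : flat_right (rrestr f) ->
  projective_resolution (P := fun i => ind f (P i)) (V := ind f V)
    (fun i => ind_map f (linear_of (res_d_hom res i).1))
    (ind_map f (linear_of (res_aug_hom res).1)).
Proof.
move=> flat; split.
- by move=> i; apply/ind_projective/(res_projective res).
- by apply: ind_map_hom => y b; apply: (res_aug_hom res).2.
- by move=> i; apply: ind_map_hom => y b; apply: (res_d_hom res i).2.
- exact/ind_surj/(res_aug_surj res).
- move=> z; split=> [|[w <-]].
    by apply: ind_flat_exact => // y /(res_exact0 res).
  transitivity (ind_map f (\0%R : {linear P 1%N -> V}) w).
    by apply: tensor_map_comp => // x /=; apply/esym/(res_exact0 res); exists x.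
  move: w; apply: ind_ext => [u v|u v|x y]; first exact: ind_map_zmod.
    by rewrite subrr.
  by rewrite ind_mapE (zmod_morph0 (itens_zmodr f x)).
move=> i z; split=> [|[w <-]].
  by apply: ind_flat_exact => // y /(res_exactS res).
transitivity (ind_map f (\0%R : {linear P i.+2 -> P i}) w).
  by apply: tensor_map_comp => // x /=; apply/esym/(res_exactS res); exists x.
move: w; apply: ind_ext => [u v|u v|x y]; first exact: ind_map_zmod.
  by rewrite subrr.
by rewrite ind_mapE (zmod_morph0 (itens_zmodr f x)).
Qed.

End InducedResolution.

Section FlatComposition.
Variables (R1 R2 R3 : pzRingType).
Variables (f : {rmorphism R1 -> R2}) (g : {rmorphism R2 -> R3}).
Variable h : {rmorphism R1 -> R3}.
Hypothesis hE : h =1 g \o f.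

(** With [merge], the natural isomorphism between R3 (x)_R1 Y and R3 (x)_R2 (R2 (x)_R1 Y). *)
Let split (Y : lmodType R1) : ind h Y -> ind g (ind f Y) :=
  ind_lift (fun y => itens g 1 (itens f 1 y)).

Let split_rules Y : zmod_morphism (split (Y := Y)) /\
  forall x (y : Y), split (itens h x y) = itens g x (itens f 1 y).
Proof.
have uB : zmod_morphism (fun y : Y => itens g 1 (itens f 1 y)).
  by move=> y y'; rewrite !itens_zmodr.
have uZ r (y : Y) :
    itens g 1 (itens f 1 (r *: y)) = h r *: itens g 1 (itens f 1 y).
  by rewrite !itens1_scale hE.
split; first exact: ind_lift_zmod.
by move=> x y; rewrite /split ind_liftE // -itensE.
Qed.

Let merge (Y : lmodType R1) : ind g (ind f Y) -> ind h Y :=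
  @ind_lift _ _ g (ind f Y) (ind h Y)
    (@ind_lift _ _ f Y (lres g (ind h Y)) (itens h 1)).

Let merge_rules Y : zmod_morphism (merge (Y := Y)) /\
  forall x (y : Y), merge (itens g x (itens f 1 y)) = itens h x y.
Proof.
have uB : zmod_morphism (itens h 1 : Y -> lres g (ind h Y)).
  exact: itens_zmodr.
have uZ r y : (itens h 1 (r *: y) : lres g (ind h Y)) =
    f r *: (itens h 1 y : lres g (ind h Y)).
  by rewrite [LHS]itens1_scale hE.
have mB := ind_lift_zmod uB uZ; have mZ := ind_lift_scale uB uZ.
split; first exact: (@ind_lift_zmod _ _ g (ind f Y) (ind h Y) _ mB mZ).
move=> x y; rewrite [LHS](@ind_liftE _ _ g (ind f Y) (ind h Y) _ mB mZ).
by rewrite (ind_liftE uB uZ) scale1r -itensE.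
Qed.

(** Through [split] and [merge], induction along [h] is a natural retract of the composite of the
    two inductions, and a retract of an injective map is injective. *)
Lemma flat_comp :
  flat_right (rrestr f) -> flat_right (rrestr g) -> flat_right (rrestr h).
Proof.
move=> flatf flatg Y Y' k k_inj.
have splitK (Z : lmodType R1) (z : ind h Z) : merge (split z) = z.
  have [sB sE] := split_rules Z; have [mB mE] := merge_rules Z.
  move: z; apply: ind_ext => [u v|//|x y]; first by rewrite sB mB.
  by rewrite sE mE.
pose fk := linear_of (ind_map_linear (f := f) k).
have [sB sE] := split_rules Y; have [s'B s'E] := split_rules Y'.
have nat z : ind_map g fk (split z) = split (ind_map h k z).
  move: z; apply: ind_ext => [u v|u v|x y]; first by rewrite sB ind_map_zmod.
    by rewrite ind_map_zmod s'B.
  by rewrite sE !ind_mapE s'E /= ind_mapE.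
move=> u v kuv; rewrite -[u]splitK -[v]splitK; congr merge.
apply: (flatg _ _ fk); first exact: flatf.
by rewrite -[LHS]/(ind_map g fk _) -[RHS]/(ind_map g fk _) !nat; congr split.
Qed.

End FlatComposition.

(** * The universal property of the Otto-Pride extension *)

Section OttoPrideTheory.
Variables (M : monoidType) (S : {pred M}) (A : subMonoidType S).
Variable phi : UMagmaMorphism.type A M.
Let L := otto_pride phi.

Definition op_in (m : M) : L :=
  mquot_pi (otto_pride_rel phi) (free_prod_inl (free_monoid unit) m).

Definition op_t : L :=
  mquot_pi (otto_pride_rel phi)
    (@free_prod_inr M (free_monoid unit) [:: tt]).

Fact op_in_monoid : monoid.monoid_morphism op_in.
Proof.
by split=> [|x y]; rewrite /op_in; [rewrite !gmulf1 | rewrite !gmulfM].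
Qed.
HB.instance Definition _ := isUMagmaMorphism.Build M L op_in op_in_monoid.

Lemma op_rel (a : A) : (op_in (val a) * op_t = op_t * op_in (phi a))%g.
Proof.
rewrite /op_in /op_t -!gmulfM; apply/mquotP/gen_cong_incl.
exact: otto_pride_at.
Qed.

(** The image of M together with t generates L: induct on a word of the free product, and within a
    letter from the free monoid on t, on its length. *)
Lemma op_ind (P : L -> Prop) :
  P 1%g -> (forall m x, P x -> P (op_in m * x)%g) ->
  (forall x, P x -> P (op_t * x)%g) -> forall x, P x.
Proof.
pose W : monoidType := free_monoid (M + free_monoid unit)%type.
pose q : W -> free_prod M (free_monoid unit) := mquot_pi _.
move=> P1 Pm Pt; elim/mquotW; elim/mquotW; elim=> [//|l w IHw].
have -> : mquot_pi (@free_prod_rel M (free_monoid unit)) (l :: w) =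
    (q [:: l] * q w)%g by rewrite -gmulfM.
rewrite gmulfM; case: l => [m|s]; first exact: Pm.
elim: s => [|[] s IHs].
  rewrite -[q _]/(free_prod_inr M (1%g : free_monoid unit)).
  by rewrite !gmulf1 mul1g.
have -> : q [:: inr (tt :: s)] =
    (free_prod_inr M ([:: tt] : free_monoid unit) * q [:: inr s])%g.
  by rewrite -[RHS]gmulfM.
by rewrite gmulfM -mulgA; apply/Pt/IHs.
Qed.

Section Lift.
Variables (E : monoidType) (f : UMagmaMorphism.type M E) (e : E).
Hypothesis fe : forall a : A, (f (val a) * e = e * f (phi a))%g.

Definition op_letter (l : M + seq unit) : E :=
  match l with inl m => f m | inr s => (e ^+ size s)%g end.

Definition op_word (w : seq (M + seq unit)) : E :=
  foldr (fun l x => op_letter l * x)%g 1%g w.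

Lemma op_word_cat w w' : op_word (w ++ w') = (op_word w * op_word w')%g.
Proof. by elim: w => [|l w IHw] /=; rewrite ?mul1g // IHw mulgA. Qed.

Lemma op_word_cong w w' :
  gen_cong (@free_prod_rel M (free_monoid unit)) w w' -> op_word w = op_word w'.
Proof.
elim=> {w w'} [_ _ []||||] /=.
- by move=> x y; rewrite !mulg1 gmulfM.
- by rewrite mulg1 gmulf1.
- by move=> x y; rewrite !mulg1 size_cat expgnDr.
- by rewrite mulg1.
- by [].
- by [].
- by move=> x y z _ -> _ ->.
by move=> x x' y y' _ Ex _ Ey; rewrite [LHS]op_word_cat Ex Ey -op_word_cat.
Qed.

Definition op_free (x : free_prod M (free_monoid unit)) : E := op_word (repr x).

Lemma op_freeE w : op_free (mquot_pi _ w) = op_word w.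
Proof. by apply/op_word_cong/mquotP; rewrite /mquot_pi reprK. Qed.

Lemma op_freeM x y : op_free (x * y)%g = (op_free x * op_free y)%g.
Proof.
elim/mquotW: x => x; elim/mquotW: y => y.
by rewrite -gmulfM !op_freeE op_word_cat.
Qed.

Definition op_lift (x : L) : E := op_free (repr x).

Lemma op_liftE x : op_lift (mquot_pi _ x) = op_free x.
Proof.
have : gen_cong (otto_pride_rel phi) (repr (mquot_pi (otto_pride_rel phi) x)) x.
  by apply/mquotP; rewrite /mquot_pi reprK.
rewrite /op_lift; move: (repr _) => y.
elim=> {x y} [_ _ [a]|||x y z _ -> _ ->|x x' y y' _ Ex _ Ey] //.
  rewrite !op_freeM !op_freeE /= !mulg1 expg1; exact: fe.
by rewrite !op_freeM Ex Ey.
Qed.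

Lemma op_liftM x y : op_lift (x * y)%g = (op_lift x * op_lift y)%g.
Proof.
by elim/mquotW: x => x; elim/mquotW: y => y; rewrite -gmulfM !op_liftE op_freeM.
Qed.

Lemma op_lift_in m : op_lift (op_in m) = f m.
Proof. by rewrite op_liftE op_freeE /= mulg1. Qed.

Lemma op_lift1 : op_lift 1%g = 1%g.
Proof.
have <- : op_in 1%g = 1%g by apply: gmulf1.
by rewrite op_lift_in gmulf1.
Qed.

Lemma op_lift_t : op_lift op_t = e.
Proof. by rewrite op_liftE op_freeE /= mulg1 expg1. Qed.

End Lift.
End OttoPrideTheory.

(** * Flatness of ZL *)

Section LmodRestriction.
Variables (R T : pzRingType) (f : {rmorphism R -> T}).

Fact lres_map_linear (W W' : lmodType T) (g : {linear W -> W'}) :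
  linear (g : lres f W -> lres f W').
Proof. by move=> a x y; apply: (linearP g). Qed.
Definition lres_map (W W' : lmodType T) (g : {linear W -> W'}) :
  {linear lres f W -> lres f W'} := linear_of (lres_map_linear g).

End LmodRestriction.

(** All self-maps of a bare type under composition. A [monoidType] carries a choice structure, which
    is supplied here classically, so that actions of L become instances of its universal
    property. *)
Definition endo (D : Type) : Type := D -> D.
HB.instance Definition _ (D : Type) := gen_eqMixin (endo D).
HB.instance Definition _ (D : Type) := gen_choiceMixin (endo D).

Section Endo.
Variable D : Type.
Definition endo_mul (f g : endo D) : endo D := f \o g.
Fact endo_mulA : associative endo_mul. Proof. by []. Qed.
Fact endo_mul1 : left_id idfun endo_mul. Proof. by []. Qed.
Fact endo_mulr1 : right_id idfun endo_mul. Proof. by []. Qed.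
HB.instance Definition _ :=
  isMonoid.Build (endo D) endo_mulA endo_mul1 endo_mulr1.
End Endo.

Section Tower.
Variables (M : monoidType) (S : {pred M}) (A : subMonoidType S).
Variable phi : UMagmaMorphism.type A M.
Let L := otto_pride phi.
Let R := monoid_ring M.
Let T := monoid_ring L.
Let incl : {rmorphism monoid_ring A -> R} :=
  monoid_ring_map (val : UMagmaMorphism.type A M).
Let twist : {rmorphism monoid_ring A -> R} := monoid_ring_map phi.
Let iota : {rmorphism R -> T} := monoid_ring_map (op_in phi).
Let tau : T := << op_t phi >>.

Lemma op_ring_rel a : iota (incl a) * tau = tau * iota (twist a).
Proof.
move: a; apply: malg_ext => [a b|a b|a].
- by rewrite !raddfB mulrBl.
- by rewrite !raddfB mulrBr.
rewrite /iota /incl /twist /= /monoid_ring_map !mliftU.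
by rewrite [LHS]mr_mulUU [RHS]mr_mulUU op_rel.
Qed.

Lemma op_ring_inU m : iota << m >> = << op_in phi m >>.
Proof. exact: mliftU. Qed.

Lemma op_scaleUU (W : lmodType T) (x y : L) (w : W) :
  (<< x >> : T) *: ((<< y >> : T) *: w) = (<< (x * y)%g >> : T) *: w.
Proof.
apply: etrans (scalerA _ _ _) _.
exact: (congr1 (fun u : T => u *: w) (monoid_ringUU x y)).
Qed.

Section Layers.
Variable Y : lmodType R.

(* The degree k part of ZL (x)_ZM Y with respect to the number of letters t. *)
Fixpoint layer (k : nat) : lmodType R :=
  if k is k'.+1 then ind incl (lres twist (layer k')) else Y.

(** The full product of the layers instead of their direct sum: the action is then defined without
    any bookkeeping of supports, and finiteness is recovered in [layer_act_sum]. *)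
Let D : Type := forall k, layer k.

Definition layer_in (m : M) : endo D := fun F k => (<< m >> : R) *: F k.

Fact layer_in_monoid : monoid.monoid_morphism layer_in.
Proof.
split=> [|m m']; apply/funext => F; apply: functional_extensionality_dep => k.
  exact: scale1r.
by rewrite /layer_in /= [RHS]scalerA [_ * _]mr_mulUU.
Qed.
HB.instance Definition _ :=
  isUMagmaMorphism.Build M (endo D) layer_in layer_in_monoid.

(** Multiplication by t raises the degree by one, so nothing arrives in degree 0. *)
Definition layer_t : endo D := fun F k =>
  match k return layer k with
  | 0 => 0
  | k'.+1 => itens incl 1 (F k' : lres twist (layer k'))
  end.

(** The relation a t = t phi(a) is the balancing of the tensor product over ZA: [a] acts by
    inclusion on the left factor and, through [lres twist], as phi(a) on the right one. *)
Fact layer_rel (a : A) :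
  (layer_in (val a) * layer_t = layer_t * layer_in (phi a))%g.
Proof.
apply/funext => F; apply: functional_extensionality_dep => -[|k].
  exact: scaler0.
have inclE : incl << a >> = << val a >> by apply: mliftU.
have twistE : twist << a >> = << phi a >> by apply: mliftU.
transitivity (itens incl 1 ((<< a >> : monoid_ring A) *: (F k : lres twist _))).
  by rewrite itens1_scale inclE.
by congr itens; rewrite /layer_in -twistE.
Qed.

Definition layer_act : L -> endo D := op_lift layer_in layer_t.

Lemma layer_act1 F : layer_act 1%g F = F.
Proof. by rewrite /layer_act (op_lift1 layer_rel). Qed.
Lemma layer_act_in m x F k :
  layer_act (op_in phi m * x)%g F k = (<< m >> : R) *: layer_act x F k.
Proof. by rewrite /layer_act (op_liftM layer_rel) (op_lift_in layer_rel). Qed.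
Lemma layer_act_t x F :
  layer_act (op_t phi * x)%g F = layer_t (layer_act x F).
Proof. by rewrite /layer_act (op_liftM layer_rel) (op_lift_t layer_rel). Qed.

End Layers.
Arguments layer_act : clear implicits.

Lemma layer_actM Y x x' F :
  layer_act Y (x * x')%g F = layer_act Y x (layer_act Y x' F).
Proof. by rewrite /layer_act (op_liftM (@layer_rel Y)). Qed.

Lemma layer_actB Y x (F G H : forall k, layer Y k) :
  (forall k, H k = F k - G k) ->
  forall k, layer_act Y x H k = layer_act Y x F k - layer_act Y x G k.
Proof.
move=> HE; elim/op_ind: x => [|m x IHx|x IHx] k.
- by rewrite !layer_act1.
- by rewrite !layer_act_in IHx scalerBr.
rewrite !layer_act_t; case: k => [|k] /=; first by rewrite subrr.
by rewrite IHx itens_zmodr.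
Qed.

(** * Coordinates of T (x)_R Y in the layers *)

Section LayerSum.
Variable Y : lmodType R.

(** Inserts the letter t after each ring factor of the tower: r_k (x) ... (x) r_1 (x) y goes to r_k
    t ... r_1 t (x) y. *)
Fixpoint layer_out (k : nat) : layer Y k -> ind iota Y :=
  match k return layer Y k -> ind iota Y with
  | 0 => itens iota 1
  | k'.+1 =>
      @ind_lift _ _ incl (lres twist (layer Y k')) (lres iota (ind iota Y))
        (fun z => tau *: layer_out (k := k') z)
  end.
Arguments layer_out : clear implicits.

Let shift k (z : lres twist (layer Y k)) : lres iota (ind iota Y) :=
  tau *: layer_out k z.

Let shiftB k : zmod_morphism (layer_out k) -> zmod_morphism (@shift k).
Proof. by move=> oB z z'; rewrite /shift oB scalerBr. Qed.

Let shiftZ k :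
  (forall (r : R) z, layer_out k (r *: z) = iota r *: layer_out k z) ->
  forall a z, @shift k (a *: z) = incl a *: shift z.
Proof.
move=> oZ a z; transitivity (tau *: (iota (twist a) *: layer_out k z)).
  exact: (congr1 (fun w => tau *: w) (oZ (twist a) z)).
by rewrite scalerA -op_ring_rel -scalerA.
Qed.

Lemma layer_out_rules k : zmod_morphism (layer_out k) /\
  forall (r : R) z, layer_out k (r *: z) = iota r *: layer_out k z.
Proof.
elim: k => [|k [IHB IHZ]].
  by split; [apply: itens_zmodr | apply: itens1_scale].
split; first exact: (ind_lift_zmod (shiftB IHB) (shiftZ IHZ)).
exact: (ind_lift_scale (shiftB IHB) (shiftZ IHZ)).
Qed.

Lemma layer_out_zmod k : zmod_morphism (layer_out k).
Proof. by case: (layer_out_rules k). Qed.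

Arguments layer_out_zmod : clear implicits.

Lemma layer_out_scale k (r : R) z :
  layer_out k (r *: z) = iota r *: layer_out k z.
Proof. by case: (layer_out_rules k). Qed.

Lemma layer_outS k z :
  layer_out k.+1 (itens incl 1 (z : lres twist (layer Y k))) =
  tau *: layer_out k z.
Proof.
have [oB oZ] := layer_out_rules k.
by apply: etrans (ind_liftE (shiftB oB) (shiftZ oZ) 1 z) _; rewrite scale1r.
Qed.

(** The constant [c] counts the letters t in a word for [x]. Acting by [x] moves the support up by
    at most [c], so every truncation from N + c on already gives the whole sum, and on whole sums
    the action turns into multiplication by [x]. [c] must depend on [x] alone for the induction to
    pass to the shifted families. *)
Lemma layer_act_sum (x : L) :
  exists c : nat, forall (F : forall k, layer Y k) (N : nat),
  (forall k, (N <= k)%N -> F k = 0) ->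
  (forall k, (N + c <= k)%N -> layer_act Y x F k = 0) /\
  forall K : nat, (N + c <= K)%N ->
    \sum_(k < K) layer_out k (layer_act Y x F k) =
    (<< x >> : T) *: \sum_(k < K) layer_out k (F k).
Proof.
elim/op_ind: x => [|m x [c IHc]|x [c IHc]].
- exists 0%N => F N F0; rewrite addn0.
  split=> [k|K _]; rewrite !layer_act1 ?scale1r //.
  exact: F0.
- exists c => F N /IHc[F0 FS]; split=> [k /F0|K /FS IH].
    by rewrite layer_act_in => ->; rewrite scaler0.
  transitivity (iota << m >> *: \sum_(k < K) layer_out k (layer_act Y x F k)).
    rewrite scaler_sumr; apply: eq_bigr => k _.
    rewrite layer_act_in.
    exact: (layer_out_scale << m >> (layer_act Y x F k)).
  rewrite IH.
  rewrite op_ring_inU; exact: op_scaleUU.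
exists c.+1 => F N /IHc[F0 FS]; rewrite addnS; split=> [[//|k] Nk|[//|K] NK].
  by rewrite layer_act_t /= F0 // (zmod_morph0 (itens_zmodr _ _)).
rewrite big_ord_recl layer_act_t [layer_t _ _]/=.
rewrite (zmod_morph0 (layer_out_zmod 0)) add0r.
transitivity
  (tau *: \sum_(k < K.+1) layer_out k (layer_act Y x F k)); last first.
  have E0 := congr1 (fun w => tau *: w) (FS K.+1 (ltnW NK)).
  apply: (etrans E0).
  exact: op_scaleUU.
(* The shift pushes index [K] out of the truncation; this loses nothing, since N + c <= K makes the
   family vanish there. *)
rewrite big_ord_recr /= F0 // (zmod_morph0 (layer_out_zmod K)) addr0.
rewrite scaler_sumr.
apply: eq_bigr => k _; exact: layer_outS.
Qed.

Definition layer0 (y : Y) (k : nat) : layer Y k :=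
  if k is k'.+1 return layer Y k then 0 else y.

Definition layer_coord (k : nat) : ind iota Y -> layer Y k :=
  tensor_lift (fun (x : rrestr iota) (y : Y) =>
    mlift (fun l => layer_act Y l (layer0 y) k) (x : T)).

Fact layer_coord_rules k : zmod_morphism (layer_coord k) /\
  forall x y, layer_coord k (itens iota x y) =
    mlift (fun l => layer_act Y l (layer0 y) k) x.
Proof.
pose h (x : rrestr iota) (y : Y) :=
  mlift (fun l => layer_act Y l (layer0 y) k) (x : T).
have hBl y : zmod_morphism (h^~ y) by move=> x x'; apply: raddfB.
have hBr x : zmod_morphism (h x).
  move=> y y'; move: x; apply: malg_ext => [x x'|x x'|l].
  - exact: raddfB.
  - by rewrite (hBl y) (hBl y') !opprD addrACA.
  rewrite /h !mliftU; apply: layer_actB => -[|j] //=.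
  by rewrite subrr.
have hZ (a : R) (x : rrestr iota) y : h ((a : R^c) *: x) y = h x (a *: y).
  move: x; apply: malg_ext => [x x'|x x'|l].
  - by rewrite scalerBr hBl.
  - exact: raddfB.
  move: a; apply: malg_ext => [a a'|a a'|m].
  - by rewrite -hBl -scalerBl.
  - by rewrite scalerBl hBr.
  have -> : ((<< m >> : R^c) *: (<< l >> : rrestr iota)) =
      << (l * op_in phi m)%g >>.
    rewrite -[LHS]/((<< l >> : T) * iota << m >>).
    by rewrite op_ring_inU monoid_ringUU.
  (* The image of m acts on [y] placed in degree 0 by replacing it with m y, so both sides are [l]
     acting on the same family. *)
  rewrite /h !mliftU layer_actM; congr (layer_act Y l _ k).
  apply: functional_extensionality_dep => j.
  rewrite -[op_in phi m]mulg1 layer_act_in layer_act1.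
  by case: j => //= j; rewrite scaler0.
split; first exact: (tensor_lift_zmod hBl hBr hZ).
by move=> x y; apply: (tensor_liftE hBl hBr hZ).
Qed.

Lemma layer_coord_zmod k : zmod_morphism (layer_coord k).
Proof. by case: (layer_coord_rules k). Qed.

Arguments layer_coord_zmod : clear implicits.

Lemma layer_coordE k l y :
  layer_coord k (itens iota << l >> y) = layer_act Y l (layer0 y) k.
Proof. by case: (layer_coord_rules k) => _ ->; rewrite mliftU. Qed.

(** This is the half of the decomposition into layers that flatness rests on: an element is restored
    from finitely many of its coordinates. On l (x) y it is [layer_act_sum] for the family that is
    [y] in degree 0. *)
Lemma layer_coordK z : exists N, forall K : nat, (N <= K)%N ->
  \sum_(k < K) layer_out k (layer_coord k z) = z.
Proof.
have PB u v : (exists N, forall K : nat, (N <= K)%N ->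
      \sum_(k < K) layer_out k (layer_coord k u) = u) ->
    (exists N, forall K : nat, (N <= K)%N ->
      \sum_(k < K) layer_out k (layer_coord k v) = v) ->
    exists N, forall K : nat, (N <= K)%N ->
      \sum_(k < K) layer_out k (layer_coord k (u - v)) = u - v.
  move=> [N uE] [N' vE]; exists (maxn N N') => K.
  rewrite geq_max => /andP[NK N'K].
  rewrite -{2}(uE K NK) -{2}(vE K N'K) -sumrB; apply: eq_bigr => k _.
  by rewrite layer_coord_zmod layer_out_zmod.
move: z; apply: ind_ind => // x y.
elim/malg_ind: x => [l||u v Pu Pv].
(* The 1 bounds the support of [layer0 y], which sits in degree 0. *)
- have [c cP] := layer_act_sum l; exists (1 + c)%N => K cK.
  have [|_ /(_ K cK)] := cP (layer0 y) 1%N; first by case.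
  under eq_bigr do rewrite -layer_coordE.
  move=> ->; case: K cK => // K _.
  rewrite big_ord_recl /= big1 ?addr0 => [|k _]; first by rewrite -itensE.
  exact: (zmod_morph0 (layer_out_zmod k.+1)).
- exists 0%N => K _; rewrite (zmod_morph0 (itens_zmodl _ y)) big1 // => k _.
  rewrite (zmod_morph0 (layer_coord_zmod _)).
  by rewrite (zmod_morph0 (layer_out_zmod _)).
by rewrite itens_zmodl; apply: PB.
Qed.

End LayerSum.

Section LayerMap.
Variables (Y Y' : lmodType R) (g : {linear Y -> Y'}).

Fixpoint layer_map (k : nat) : {linear layer Y k -> layer Y' k} :=
  match k return {linear layer Y k -> layer Y' k} with
  | 0 => g
  | k'.+1 =>
      linear_of (ind_map_linear (f := incl) (lres_map twist (layer_map k')))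
  end.

Lemma layer_map_inj : flat_right (rrestr incl) -> injective g ->
  forall k, injective (layer_map k).
Proof. by move=> flat g_inj; elim=> [//|k IHk]; apply: flat. Qed.

Lemma layer_map_act x (F : forall k, layer Y k) k :
  layer_map k (layer_act Y x F k) =
  layer_act Y' x (fun j => layer_map j (F j)) k.
Proof.
elim/op_ind: x k => [|m x IHx|x IHx] k.
- by rewrite !layer_act1.
- by rewrite !layer_act_in -IHx; apply: linearZ_LR.
rewrite !layer_act_t; case: k => [|k] /=; first exact: raddf0.
by rewrite ind_mapE -IHx.
Qed.

Lemma layer_map_coord k z :
  layer_map k (layer_coord k z) = layer_coord k (ind_map iota g z).
Proof.
move: z; apply: ind_ext => [u v|u v|x y].
- by rewrite layer_coord_zmod raddfB.
- by rewrite ind_map_zmod layer_coord_zmod.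
rewrite ind_mapE; move: x; apply: malg_ext => [u v|u v|l].
- by rewrite itens_zmodl layer_coord_zmod raddfB.
- by rewrite itens_zmodl layer_coord_zmod.
rewrite !layer_coordE layer_map_act; congr (layer_act Y' l _ k).
apply: functional_extensionality_dep => -[//|j]; exact: raddf0.
Qed.

End LayerMap.

(** An element killed by the induced map has all its coordinates killed by the layer maps. These are
    injective by applying the flatness of R over ZA once for each degree, so all coordinates vanish,
    and with them the element. *)
Lemma op_flat_right : flat_right (rrestr incl) -> flat_right (rrestr iota).
Proof.
move=> flat Y Y' g g_inj u v guv.
apply/eqP; rewrite -subr_eq0; apply/eqP.
pose z : ind iota Y := u - v.
have z0 : ind_map iota g z = 0.
  by rewrite ind_map_zmod; apply/eqP; rewrite subr_eq0; apply/eqP.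
have c0 k : layer_coord k z = 0.
  apply: (layer_map_inj flat g_inj (k := k)).
  by rewrite layer_map_coord z0 (zmod_morph0 (@layer_coord_zmod Y' k)) raddf0.
have [N zE] := layer_coordK z; rewrite -[LHS](zE N (leqnn N)) big1 // => k _.
by rewrite c0 (zmod_morph0 (@layer_out_zmod Y k)).
Qed.

End Tower.

(** * Relative differentials *)

(* [b x y] stands for x (x) y in the bimodule B = T (x)_R T, where R acts on T
   on the right through f and on the left through g. *)
Record is_bitensor (R T : pzRingType) (f g : {rmorphism R -> T})
    (B : bimodType T T) (b : T -> T -> B) : Prop := {
  bt_scale : forall a x y, a *: b x y = b (a * x) y;
  bt_rscale : forall x y a, rscale (b x y) a = b x (y * a);
  bt_mid : forall x r y, b (x * f r) y = b x (g r * y);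
  bt_zmodl : forall y, zmod_morphism (b^~ y);
  bt_zmodr : forall x, zmod_morphism (b x);
  bt_ext : forall (W : zmodType) (h k : B -> W),
    zmod_morphism h -> zmod_morphism k ->
    (forall x y, h (b x y) = k (b x y)) -> h =1 k;
  bt_hom : forall (W : bimodType T T) (w : W),
    (forall r, f r *: w = rscale w (g r)) ->
    exists2 h : B -> W, bimod_hom h & forall x y, h (b x y) = x *: rscale w y;
  bt_additive : forall (W : zmodType) (k : T -> T -> W),
    (forall y, zmod_morphism (k^~ y)) -> (forall x, zmod_morphism (k x)) ->
    (forall x r y, k (x * f r) y = k x (g r * y)) ->
    exists2 h : B -> W, zmod_morphism h & forall x y, h (b x y) = k x y
}.

Section Bitensor.
Variables (R T : pzRingType) (f g : {rmorphism R -> T}).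

(** This realization of the tensor product is the bimodule reached by inducing a resolution on the
    right and then on the left. *)
Lemma ind_bitensor : is_bitensor f g
  (fun x y =>
     itens f x (y : lres g T^o) : (ind f (lres g T^o) : bimodType T T)).
Proof.
split.
- by move=> a x y; apply: scale_itens.
- by move=> x y b; apply: rscale_itens.
- by move=> x r y; apply/esym; apply: (itens_scale f x r (y : lres g T^o)).
- by move=> y x x'; apply: (@itens_zmodl _ _ f (lres g T^o) y x x').
- by move=> x y y'; apply: (@itens_zmodr _ _ f (lres g T^o) x y y').
- by move=> W h k; apply: ind_ext.
- move=> W w wP; pose u (y : lres g T^o) : W := rscale w (y : T).
  have uB : zmod_morphism u by move=> y y'; apply: (rscale_zmodr w).
  have uZ r y : u (r *: y) = f r *: u y.
    by rewrite /u scale_rscale wP [RHS]rscaleA.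
  have uH : bimod_hom (u : lres g T^o -> lres f W).
    by apply: bimod_hom_intro => // y b; apply/esym/rscaleA.
  exists (ind_lift u); first exact: (ind_lift_hom uH).
  by move=> x y; apply: (ind_liftE uB uZ).
move=> W k kBl kBr kM; pose k' (x : rrestr f) (y : lres g T^o) := k x y.
have kB'l y : zmod_morphism (k'^~ y) by move=> x x'; apply: kBl.
have kB'r x : zmod_morphism (k' x) by move=> y y'; apply: kBr.
have kZ (a : R) (x : rrestr f) y : k' ((a : R^c) *: x) y = k' x (a *: y).
  exact: kM.
exists (tensor_lift k'); first exact: tensor_lift_zmod.
by move=> x y; apply: (tensor_liftE kB'l kB'r kZ).
Qed.

End Bitensor.

(* The sequence of bimodules of relative differentials: an R-derivation on T is
   determined by its value on tau, so the kernel of T (x)_R T -> T is generated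
   by tau (x) 1 - 1 (x) tau subject only to the relation with A. *)
Section DifferentialSequence.
Variables (A R T : pzRingType) (incl twist : {rmorphism A -> R}).
Variables (iota : {rmorphism R -> T}) (left right : {rmorphism A -> T}).
Variable tau : T.
Hypothesis leftE : forall a, left a = iota (incl a).
Hypothesis rightE : forall a, right a = iota (twist a).
Hypothesis tauP : forall a, left a * tau = tau * right a.
Hypothesis gen : forall P : T -> Prop,
  P 1 -> (forall x y, P x -> P y -> P (x - y)) ->
  (forall r x, P x -> P (iota r * x)) -> (forall x, P x -> P (tau * x)) ->
  forall x, P x.
Hypothesis der : forall (V : bimodType T T) (v : V),
  (forall a, left a *: v = rscale v (right a)) ->
  exists D : T -> V,
    [/\ zmod_morphism D, forall r, D (iota r) = 0, D tau = v &
        forall x y, D (x * y) = x *: D y + rscale (D x) y].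

Variables (O B : bimodType T T) (o : T -> T -> O) (b : T -> T -> B).
Hypotheses (oP : is_bitensor left right o) (bP : is_bitensor iota iota b).

Let omegaP a : left a *: o 1 1 = rscale (o 1 1) (right a).
Proof.
rewrite (bt_scale oP) (bt_rscale oP) mulr1 -[left a]mul1r (bt_mid oP).
by rewrite mulr1 mul1r.
Qed.

Let zeta : B := b tau 1 - b 1 tau.

Let zetaP a : left a *: zeta = rscale zeta (right a).
Proof.
rewrite scalerBr (rscale_zmod (right a)) !(bt_scale bP) !(bt_rscale bP) tauP.
rewrite mul1r mulr1 rightE (bt_mid bP) mulr1 -rightE; congr (_ - _).
by rewrite -tauP leftE -(bt_mid bP) mul1r.
Qed.

(** With D(tau) = 1 (x) 1, the additive map kap(x (x) y) = D(x) y satisfies kap j = id, whence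
    injectivity, and z = j(kap z) + 1 (x) mu(z), whence exactness in the middle. *)
Lemma differential_sequence : exists (j : O -> B) (mu : B -> T^o),
    [/\ bimod_hom j, injective j, bimod_hom mu, surj mu &
        forall z, mu z = 0 <-> exists w, j w = z].
Proof.
have [D [DB Di Dt DM]] := der omegaP.
have [j jH jE] := bt_hom oP zetaP.
have [|mu muH muE] := bt_hom bP (W := T^o) (w := 1).
  by move=> r; apply: etrans (mulr1 _) (esym (mul1r _)).
have [||x r y|kap kapB kapE] := bt_additive bP (k := fun x y => rscale (D x) y).
- by move=> y x x'; rewrite DB (rscale_zmod y).
- by move=> x; apply: rscale_zmodr.
- by rewrite DM Di scaler0 add0r rscaleA.
have muxy x y : mu (b x y) = x * y.
  by rewrite muE -[RHS]/(x *: (y : T^o)); congr (_ *: _); apply: mul1r.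
have [jB muB] := (bimod_hom_zmod jH, bimod_hom_zmod muH).
have jxy x y : j (o x y) = b (x * tau) y - b x (tau * y).
  rewrite jE (rscale_zmod y) scalerBr !(bt_rscale bP) !(bt_scale bP).
  by rewrite mul1r mulr1.
have kapj w : kap (j w) = w.
  move: w; apply: (bt_ext oP) => [w w'|//|x y]; first by rewrite jB kapB.
  rewrite jxy kapB !kapE DM Dt (zmod_morphD (rscale_zmod y)) rscaleA addrK.
  by rewrite (bt_scale oP) (bt_rscale oP) mulr1 mul1r.
(* Both sides are derivations that vanish on R and agree at [tau], and R and [tau] generate T. *)
have jD x : j (D x) = b x 1 - b 1 x.
  move: x; apply: gen => [|x y IHx IHy|r x IHx|x IHx].
  - by rewrite -(rmorph1 iota) Di (zmod_morph0 jB) rmorph1 subrr.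
  - rewrite DB jB IHx IHy (bt_zmodl bP 1) (bt_zmodr bP 1).
    by rewrite !opprD addrACA.
  - rewrite DM Di (zmod_morph0 (rscale_zmod x)) addr0 (bimod_hom_scale jH) IHx.
    by rewrite scalerBr !(bt_scale bP) -(bt_mid bP) mul1r mulr1.
  rewrite DM Dt (zmod_morphD jB) (bimod_hom_scale jH) IHx.
  rewrite (bimod_hom_rscale jH) jxy scalerBr (rscale_zmod x).
  rewrite !(bt_scale bP) !(bt_rscale bP) !mulr1 !mul1r.
  by rewrite addrA subrK.
have split z : z = j (kap z) + b 1 (mu z : T).
  move: z; apply: (bt_ext bP) => [//|z z'|x y].
    by rewrite kapB jB muB (bt_zmodr bP) opprD addrACA.
  rewrite kapE (bimod_hom_rscale jH) jD (rscale_zmod y) !(bt_rscale bP).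
  by rewrite mul1r muxy subrK.
exists j, mu; split=> //.
- by move=> w w' jw; rewrite -[w]kapj jw kapj.
- by move=> y; exists (b 1 y); rewrite muxy mul1r.
move=> z; split=> [z0|[w <-]].
  exists (kap z); rewrite {2}[z]split z0.
  by rewrite (zmod_morph0 (bt_zmodr bP 1)) addr0.
move: w; apply: (bt_ext oP) => [w w'|w w'|x y]; first by rewrite jB muB.
  by rewrite subrr.
by rewrite jxy muB !muxy mulrA subrr.
Qed.

End DifferentialSequence.

(** * Mapping cones *)

Section ProductBimodule.
Variables (R S : pzRingType) (X Y : bimodType R S).

Definition prod_rscale (p : X * Y) (b : S) : X * Y :=
  (rscale p.1 b, rscale p.2 b).
Fact prod_rscaleA p b c :
  prod_rscale (prod_rscale p b) c = prod_rscale p (b * c).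
Proof. by congr pair; apply: rscaleA. Qed.
Fact prod_rscale1 p : prod_rscale p 1 = p.
Proof. by case: p => x y; congr pair; apply: rscale1. Qed.
Fact prod_rscaleDl p q b :
  prod_rscale (p + q) b = prod_rscale p b + prod_rscale q b.
Proof. by congr pair; apply: rscaleDl. Qed.
Fact prod_rscaleDr p b c :
  prod_rscale p (b + c) = prod_rscale p b + prod_rscale p c.
Proof. by congr pair; apply: rscaleDr. Qed.
Fact prod_scale_rscale (a : R) p b :
  a *: prod_rscale p b = prod_rscale (a *: p) b.
Proof. by congr pair; apply: scale_rscale. Qed.
HB.instance Definition _ := Lmodule_isBimodule.Build R S (X * Y)%type
  prod_rscaleA prod_rscale1 prod_rscaleDl prod_rscaleDr prod_scale_rscale.

Definition prod_bimod : bimodType R S := (X * Y)%type.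

Lemma prod_projective :
  projective_bimod X -> projective_bimod Y -> projective_bimod prod_bimod.
Proof.
move=> Xproj Yproj V W g f gH gS fH.
have [|||hX hXH gX] := Xproj V W g (fun x => f (x, 0)) => //.
  apply: bimod_hom_intro => [x x'|a x|x b].
  - by rewrite -(bimod_hom_zmod fH); congr f; congr pair; rewrite ?subr0.
  - by rewrite -(bimod_hom_scale fH); congr f; congr pair; rewrite ?scaler0.
  rewrite -(bimod_hom_rscale fH); congr f; congr pair.
  exact/esym/(zmod_morph0 (rscale_zmod b)).
have [|||hY hYH gY] := Yproj V W g (fun y => f (0, y)) => //.
  apply: bimod_hom_intro => [x x'|a x|x b].
  - by rewrite -(bimod_hom_zmod fH); congr f; congr pair; rewrite ?subr0.
  - by rewrite -(bimod_hom_scale fH); congr f; congr pair; rewrite ?scaler0.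
  rewrite -(bimod_hom_rscale fH); congr f; congr pair.
  exact/esym/(zmod_morph0 (rscale_zmod b)).
have gB := bimod_hom_zmod gH.
have [hXB hYB] := (bimod_hom_zmod hXH, bimod_hom_zmod hYH).
exists (fun p => hX p.1 + hY p.2) => [|[x y]].
  apply: bimod_hom_intro => [p q|a p|p b] /=.
  - by rewrite hXB hYB opprD addrACA.
  - by rewrite (bimod_hom_scale hXH) (bimod_hom_scale hYH) scalerDr.
  by rewrite (bimod_hom_rscale hXH) (bimod_hom_rscale hYH) rscaleDl.
rewrite /= (zmod_morphD gB) gX gY -(zmod_morphD (bimod_hom_zmod fH)).
by congr f; congr pair; rewrite ?addr0 ?add0r.
Qed.

Lemma prod_fg : fg_bimod X -> fg_bimod Y -> fg_bimod prod_bimod.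
Proof.
move=> [m [e eP]] [n [e' e'P]].
pose c (k : 'I_(m + n)) : prod_bimod :=
  match fintype.split k with inl i => (e i, 0) | inr i => (0, e' i) end.
exists (m + n)%N, c => -[x y].
have -> : (x, y) = (x, 0) + (0, y) :> prod_bimod.
  by congr pair; rewrite ?addr0 ?add0r.
apply: (bimod_spanD (e := c)).
  have [s ->] := eP x; exists [seq (u.1.1, lshift n u.1.2, u.2) | u <- s].
  have iB : zmod_morphism (fun x => (x, 0) : prod_bimod).
    by move=> x1 x2; congr pair; rewrite subr0.
  rewrite big_map (zmod_morph_sum iB); apply: eq_bigr => u _ /=.
  rewrite /c -[lshift n _]/(unsplit (inl _)) unsplitK; congr pair.
  by rewrite /= scaler0 (zmod_morph0 (rscale_zmod _)).
have [s ->] := e'P y; exists [seq (u.1.1, rshift m u.1.2, u.2) | u <- s].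
have iB : zmod_morphism (fun y => (0, y) : prod_bimod).
  by move=> x1 x2; congr pair; rewrite subr0.
rewrite big_map (zmod_morph_sum iB); apply: eq_bigr => u _ /=.
rewrite /c -[rshift m _]/(unsplit (inr _)) unsplitK; congr pair.
by rewrite /= scaler0 (zmod_morph0 (rscale_zmod _)).
Qed.

End ProductBimodule.

Section MappingCone.
Variables (R S : pzRingType) (X Y V : bimodType R S) (j : X -> Y) (mu : Y -> V).
Hypotheses (jH : bimod_hom j) (muH : bimod_hom mu).
Hypotheses (j_inj : injective j) (muS : surj mu).
Hypothesis exY : forall y, mu y = 0 <-> exists x, j x = y.

Variables (Q : nat -> bimodType R S) (dQ : forall i, Q i.+1 -> Q i).
Variables (P : nat -> bimodType R S) (dP : forall i, P i.+1 -> P i).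
Arguments dQ : clear implicits.
Arguments dP : clear implicits.
Variables (aQ : Q 0%N -> X) (aP : P 0%N -> Y).
Hypothesis resQ : projective_resolution dQ aQ.
Hypothesis resP : projective_resolution dP aP.

Let ddQ i y : dQ i (dQ i.+1 y) = 0.
Proof. by apply/(res_exactS resQ); exists y. Qed.
Let ddP i y : dP i (dP i.+1 y) = 0.
Proof. by apply/(res_exactS resP); exists y. Qed.
Let adQ y : aQ (dQ 0 y) = 0.
Proof. by apply/(res_exact0 resQ); exists y. Qed.
Let adP y : aP (dP 0 y) = 0.
Proof. by apply/(res_exact0 resP); exists y. Qed.

Let extendable i (f : Q i -> P i) : Prop :=
  bimod_hom f /\ forall y, exists x, dP i x = f (dQ i y).

(** The comparison theorem. Its invariant is that [f] carries boundaries to boundaries: projectivity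
    then yields the next component and exactness of [P] renews the invariant. Bundling the invariant
    with the map lets the whole family be one fixpoint over classically chosen steps. *)
Lemma chain_lift : exists f : forall i, Q i -> P i,
  [/\ forall i, bimod_hom (f i), forall q, aP (f 0%N q) = j (aQ q) &
      forall i q, dP i (f i.+1 q) = f i (dQ i q)].
Proof.
have [||f0 f0H f0E] := projective_lift (res_aug_hom resP) (f := j \o aQ)
    (res_projective resQ (i := 0%N)).
- exact: bimod_hom_comp (res_aug_hom resQ) jH.
- by move=> q; apply: (res_aug_surj resP).
have ext0 : extendable f0.
  split=> // y; apply/(res_exact0 resP).
  by rewrite f0E /= adQ (zmod_morph0 (bimod_hom_zmod jH)).
have step i (f : {f : Q i -> P i | extendable f}) :
    {f' : {f' : Q i.+1 -> P i.+1 | extendable f'} |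
      forall q, dP i (sval f' q) = sval f (dQ i q)}.
  case: f => f [fH fE]; apply: cid.
  have [||f' f'H f'E] := projective_lift (res_d_hom resP i) (f := f \o dQ i)
    (res_projective resQ (i := i.+1)) => //.
    exact: bimod_hom_comp (res_d_hom resQ i) fH.
  have ext' : extendable f'.
    split=> // y; apply/(res_exactS resP).
    by rewrite f'E /= ddQ (zmod_morph0 (bimod_hom_zmod fH)).
  by exists (exist _ f' ext').
pose F := fix F i : {f : Q i -> P i | extendable f} :=
  match i with 0 => exist _ f0 ext0 | i'.+1 => sval (step i' (F i')) end.
exists (fun i => sval (F i)); split=> [i||i q].
- by case: (svalP (F i)).
- exact: f0E.
exact: (svalP (step i (F i))).
Qed.

Definition cone (i : nat) : bimodType R S :=
  if i is i'.+1 then prod_bimod (P i) (Q i') else P 0%N.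

(** Since [P] and [Q] are exact, the homology of the cone is that of [j]: its cokernel [V] in degree
    0 and its kernel, zero by injectivity, in degree 1. *)
Lemma cone_resolution :
  exists (d : forall i, cone i.+1 -> cone i) (aug : cone 0 -> V),
    projective_resolution d aug.
Proof.
have [f [fH f0E fE]] := chain_lift.
have fB i : zmod_morphism (f i) := bimod_hom_zmod (fH i).
have dPB i : zmod_morphism (dP i) := bimod_hom_zmod (res_d_hom resP i).
have dQB i : zmod_morphism (dQ i) := bimod_hom_zmod (res_d_hom resQ i).
have aPB : zmod_morphism aP := bimod_hom_zmod (res_aug_hom resP).
have aQB : zmod_morphism aQ := bimod_hom_zmod (res_aug_hom resQ).
have jB : zmod_morphism j := bimod_hom_zmod jH.
pose d1 i (x : prod_bimod (P i.+1) (Q i)) : P i := dP i x.1 + f i x.2.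
have d1H i : bimod_hom (@d1 i).
  apply: bimod_hom_intro => [p q|a p|p b].
  - by rewrite /d1 /= dPB fB opprD addrACA.
  - rewrite /d1 /= (bimod_hom_scale (res_d_hom resP i)).
    by rewrite (bimod_hom_scale (fH i)) scalerDr.
  rewrite /d1 /= (bimod_hom_rscale (res_d_hom resP i)).
  by rewrite (bimod_hom_rscale (fH i)) rscaleDl.
pose d i : cone i.+1 -> cone i := match i return cone i.+1 -> cone i with
  | 0 => @d1 0 | i'.+1 => fun x => (@d1 i'.+1 x, - dQ i' x.2) end.
have d1_0 i (p : P i.+1) (q : Q i) : d1 i (p, q) = 0 -> dP i p = - f i q.
  by move=> /eqP; rewrite addr_eq0 => /eqP.
(* Once q = dQ q', the element p + f q' is a cycle of [P]; a chain bounding it, paired with - q',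
   bounds the pair. The sign matches the one on [dQ] in the differential of the cone. *)
have d1K i (p : P i.+1) (q : Q i) q' : dQ i q' = q -> d1 i (p, q) = 0 ->
    exists x : prod_bimod (P i.+2) (Q i.+1), (d1 i.+1 x, - dQ i x.2) = (p, q).
  move=> qE /d1_0 pE.
  have [p' p'E] : exists p', dP i.+1 p' = p + f i.+1 q'.
    by apply/(res_exactS resP); rewrite (zmod_morphD (dPB i)) pE fE qE addNr.
  exists (p', - q'); rewrite /d1 /= p'E.
  by rewrite (zmod_morphN (fB _)) (zmod_morphN (dQB i)) opprK qE addrK.
have d1d i (x : prod_bimod (P i.+2) (Q i.+1)) :
    d1 i (d1 i.+1 x, - dQ i x.2) = 0.
  rewrite /d1 /= (zmod_morphD (dPB i)) ddP add0r fE.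
  by rewrite (zmod_morphN (fB i)) subrr.
exists d, (mu \o aP); split.
- case=> [|i]; first exact: (res_projective resP).
  exact/prod_projective/(res_projective resQ)/(res_projective resP).
- exact: bimod_hom_comp (res_aug_hom resP) muH.
- case=> [|i]; first exact: d1H.
  apply: bimod_hom_intro => [p q|a p|p b]; congr pair.
  + exact: (bimod_hom_zmod (d1H i.+1)).
  + by rewrite /= dQB !opprD.
  + exact: (bimod_hom_scale (d1H i.+1)).
  + by rewrite /= (bimod_hom_scale (res_d_hom resQ i)) scalerN.
  + exact: (bimod_hom_rscale (d1H i.+1)).
  rewrite /= (bimod_hom_rscale (res_d_hom resQ i)).
  exact/esym/(zmod_morphN (rscale_zmod b)).
- move=> v; have [y <-] := muS v.
  by have [p <-] := res_aug_surj resP y; exists p.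
- move=> p; split=> [/exY[x jx]|[[p' q] <-]].
    have [q qE] := res_aug_surj resQ x.
    have [p' p'E] : exists p', dP 0 p' = p - f 0%N q.
      by apply/(res_exact0 resP); rewrite aPB f0E qE jx subrr.
    by exists (p', q); rewrite /= /d1 /= p'E subrK.
  apply/exY; exists (aQ q).
  by rewrite /= /d1 /= (zmod_morphD aPB) adP add0r f0E.
case=> [|i] [p q]; split=> [dpq|[x <-]].
(* In degree 1 there is no condition on dQ q; instead j(aQ q) = aP(f q) = - aP(dP p) = 0, and [j] is
   injective. *)
- have /(res_exact0 resQ)[q' q'E] : aQ q = 0.
    apply: j_inj; rewrite (zmod_morph0 jB) -f0E -[f _ _]opprK -(d1_0 _ _ _ dpq).
    by rewrite (zmod_morphN aPB) adP oppr0.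
  exact: d1K q'E dpq.
- exact: d1d.
- case: dpq => dpq dq; have /(res_exactS resQ)[q' q'E] : dQ i q = 0.
    by apply/eqP; rewrite -oppr_eq0; apply/eqP.
  exact: d1K q'E dpq.
congr pair; first exact: d1d.
by rewrite /= (zmod_morphN (dQB i)) ddQ !oppr0.
Qed.

(** The cone holds [Q i] in degree [i.+1], so finite generation of [Q] is called for up to n - 1
    only. *)
Lemma cone_fg (n : enat) :
  (forall i, enat_le i n -> fg_bimod (P i)) ->
  (forall i, enat_le i (enat_pred n) -> fg_bimod (Q i)) ->
  forall i, enat_le i n -> fg_bimod (cone i).
Proof.
move=> Pfg Qfg [|i] ni; first exact: Pfg.
apply: prod_fg; [exact: Pfg | apply: Qfg].
by case: n ni {Pfg} => //= -[].
Qed.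

End MappingCone.

(** * Derivations on ZL *)

(* The split extension L |x V of a monoid by a bimodule: its sections over L
   are the derivations L -> V. *)
Section DerivationMonoid.
Variables (L : monoidType) (V : bimodType (monoid_ring L) (monoid_ring L)).

Definition dmonoid : Type := (L * V)%type.
HB.instance Definition _ := Choice.on dmonoid.

Definition dmonoid_mul (p q : dmonoid) : dmonoid :=
  ((p.1 * q.1)%g, (<< p.1 >> : monoid_ring L) *: q.2 +
                  rscale p.2 (<< q.1 >> : monoid_ring L)).
Definition dmonoid_one : dmonoid := (1%g, 0).

Fact dmonoid_mulA : associative dmonoid_mul.
Proof.
move=> [x u] [y v] [z w]; congr pair; rewrite /= ?mulgA //.
rewrite scalerDr rscaleDl scalerA rscaleA scale_rscale -addrA.
by rewrite (monoid_ringUU x y) (monoid_ringUU y z).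
Qed.
Fact dmonoid_mul1 : left_id dmonoid_one dmonoid_mul.
Proof.
move=> [x u]; rewrite /dmonoid_mul /= mul1g; congr pair.
by rewrite [_ *: _]scale1r (zmod_morph0 (rscale_zmod _)) addr0.
Qed.
Fact dmonoid_mulr1 : right_id dmonoid_one dmonoid_mul.
Proof.
move=> [x u]; rewrite /dmonoid_mul /= mulg1; congr pair.
by rewrite [rscale _ _]rscale1 scaler0 add0r.
Qed.
HB.instance Definition _ :=
  isMonoid.Build dmonoid dmonoid_mulA dmonoid_mul1 dmonoid_mulr1.

End DerivationMonoid.

(** * From generation and the universal property of L to its resolution *)

Section OttoPrideSequence.
Variables (A M L : monoidType) (j phi : UMagmaMorphism.type A M).
Variables (i : UMagmaMorphism.type M L) (t : L).
Hypothesis rel : forall a, (i (j a) * t = t * i (phi a))%g.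
Hypothesis gen : forall P : L -> Prop,
  P 1%g -> (forall m x, P x -> P (i m * x)%g) ->
  (forall x, P x -> P (t * x)%g) -> forall x, P x.
Hypothesis lift : forall (E : monoidType) (f : UMagmaMorphism.type M E) (e : E),
  (forall a, (f (j a) * e = e * f (phi a))%g) ->
  exists h : L -> E,
    [/\ forall x y, h (x * y)%g = (h x * h y)%g,
        forall m, h (i m) = f m & h t = e].

Let R := monoid_ring M.
Let T := monoid_ring L.
Variables incl twist : {rmorphism monoid_ring A -> R}.
Variables iota : {rmorphism R -> T}.
Hypothesis inclU : forall a, incl << a >> = << j a >>.
Hypothesis twistU : forall a, twist << a >> = << phi a >>.
Hypothesis iotaU : forall m, iota << m >> = << i m >>.
Let tau : T := << t >>.

Section Derivation.
Variables (V : bimodType T T) (v : V).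
Hypothesis vP : forall a : A,
  (<< i (j a) >> : T) *: v = rscale v (<< i (phi a) >> : T).

Definition deriv_in (m : M) : dmonoid V := (i m, 0).

Fact deriv_in_monoid : monoid.monoid_morphism deriv_in.
Proof.
split=> [|x y]; congr pair; rewrite ?gmulf1 ?gmulfM //=.
by rewrite scaler0 (zmod_morph0 (rscale_zmod _)) addr0.
Qed.
HB.instance Definition _ :=
  isUMagmaMorphism.Build M (dmonoid V) deriv_in deriv_in_monoid.

(** The condition on [v] says exactly that (t, v) satisfies the defining relations in the split
    extension. The first component of the resulting morphism is the identity, by generation, so the
    second one is a derivation. *)
Lemma op_derivation : exists delta : L -> V,
  [/\ forall m, delta (i m) = 0, delta t = v &
      forall x y, delta (x * y)%g =
        (<< x >> : T) *: delta y + rscale (delta x) (<< y >> : T)].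
Proof.
pose e : dmonoid V := (t, v).
have [a|h [hM hi ht]] := lift (f := deriv_in) (e := e).
  congr pair; rewrite /= ?rel //.
  by rewrite scaler0 add0r (zmod_morph0 (rscale_zmod _)) addr0 vP.
have h1 x : (h x).1 = x.
  elim/gen: x => [|m x IHx|x IHx].
  - have <- : i 1%g = 1%g by apply: gmulf1.
    by rewrite hi.
  - by rewrite hM hi /= IHx.
  by rewrite hM ht /= IHx.
exists (fun x => (h x).2); split=> [m||x y].
- by rewrite hi.
- by rewrite ht.
by rewrite hM /= !h1.
Qed.

End Derivation.

Lemma op_ring_derivation (V : bimodType T T) (v : V) :
  (forall a, iota (incl a) *: v = rscale v (iota (twist a))) ->
  exists D : T -> V,
    [/\ zmod_morphism D, forall r, D (iota r) = 0, D tau = v &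
        forall x y, D (x * y) = x *: D y + rscale (D x) y].
Proof.
move=> vP; have [a|delta [di dt dM]] := op_derivation (V := V) (v := v).
  by have := vP << a >>; rewrite inclU twistU !iotaU.
pose D : T -> V := mlift delta.
have DU x : D << x >> = delta x by apply: mliftU.
have DB : zmod_morphism D by move=> x y; apply: raddfB.
exists D; split=> [//|||].
- apply: malg_ext => [r s|r s|m]; first by rewrite raddfB DB.
    by rewrite subrr.
  by rewrite iotaU DU di.
- by rewrite DU dt.
move=> x y; move: x; apply: malg_ext => [x x'|x x'|x].
- by rewrite mulrBl DB.
- by rewrite scalerBl DB (rscale_zmod y) !opprD addrACA.
move: y; apply: malg_ext => [y y'|y y'|y].
- by rewrite mulrBr DB.
- by rewrite DB scalerBr (rscale_zmodr (D << x >>)) !opprD addrACA.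
by rewrite monoid_ringUU !DU dM.
Qed.

Lemma op_ring_gen (P : T -> Prop) :
  P 1 -> (forall x y, P x -> P y -> P (x - y)) ->
  (forall r x, P x -> P (iota r * x)) -> (forall x, P x -> P (tau * x)) ->
  forall x, P x.
Proof.
move=> P1 PB Pi Pt x; elim/malg_ind: x => [x||]; last exact: PB.
  elim/gen: x => [//|m x Px|x Px].
    rewrite -(monoid_ringUU (i m) x).
    by rewrite -iotaU; apply: Pi.
  by rewrite -(monoid_ringUU t x); apply: Pt.
by rewrite -(subrr (1 : T)); apply: PB.
Qed.

Lemma op_ring_relation a : iota (incl a) * tau = tau * iota (twist a).
Proof.
move: a; apply: malg_ext => [a b|a b|a].
- by rewrite !raddfB mulrBl.
- by rewrite !raddfB mulrBr.
by rewrite inclU twistU !iotaU !monoid_ringUU rel.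
Qed.

(** Right induction comes first, while the resolutions of ZM and ZA still split on the right. The
    results resolve T over (ZM, ZL) and over (ZA, ZL), and left induction of these asks only for
    flatness along [iota] and along its composite with [incl]. *)
Lemma bi_FP_extension (n : enat) :
  flat_right (rrestr incl) -> flat_right (rrestr iota) ->
  bi_FP n M -> bi_FP (enat_pred n) A -> bi_FP n L.
Proof.
move=> flat_incl flat_iota [P [dP [aP [resP P_fg]]]] [Q [dQ [aQ [resQ Q_fg]]]].
pose left : {rmorphism monoid_ring A -> T} := iota \o incl.
pose right : {rmorphism monoid_ring A -> T} := iota \o twist.
have flat_left' : flat_right (rrestr left).
  exact: (flat_comp (f := incl) (g := iota)).
have resY := ind_resolution (rind_resolution iota resP) flat_iota.
have resX := ind_resolution (rind_resolution right resQ) flat_left'.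
have leftE a : left a = iota (incl a) by [].
have rightE a : right a = iota (twist a) by [].
have tauP : forall a, left a * tau = tau * right a.
  exact: op_ring_relation.
have [j' [mu [jH j_inj muH muS ex]]] := differential_sequence leftE rightE tauP
  op_ring_gen op_ring_derivation
  (ind_bitensor left right) (ind_bitensor iota iota).
have [d [aug res]] := cone_resolution jH muH j_inj muS ex resX resY.
exists (cone _ _), d, aug; split=> //.
by apply: cone_fg => k nk; apply/ind_fg/rind_fg; [apply: P_fg | apply: Q_fg].
Qed.

End OttoPrideSequence.

Theorem theorem5p17 (M : monoidType) (S : {pred M}) (A : subMonoidType S)
    (phi : UMagmaMorphism.type A M) (n : enat) :
  injective phi ->
  flat_right (rrestr (monoid_ring_map (val : UMagmaMorphism.type A M))) ->
  flat_left (lrestr (monoid_ring_map (val : UMagmaMorphism.type (image_monoid phi) M))) ->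
  enat_le 1 n ->
  bi_FP n M ->
  bi_FP (enat_pred n) A ->
  bi_FP n (otto_pride phi).
Proof.
move=> _ flat_incl _ _ FPM FPA.
apply: (bi_FP_extension (@op_rel M S A phi) (@op_ind M S A phi) _
  (@monoid_ring_mapU _ _ _) (@monoid_ring_mapU _ _ phi)
  (@monoid_ring_mapU _ _ (op_in phi)) flat_incl (op_flat_right flat_incl)
  FPM FPA).
move=> E f e fe; exists (op_lift f e).
by split; [exact: op_liftM | exact: op_lift_in | exact: op_lift_t].
Qed.
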